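(* Let $p\ge1$ and let $w$ be a weight on $[0,2\pi)$ such that $\log^+w\in L^p$. Then the following statements about $w$ are equivalent: (i) $\log w\in L^p$; (ii) $L^w_p=L_p$; (iii) the metrics $\rho^w_p$ and $\rho_p$ define the same topology on $L_p$; (iv) $(L_p,\rho^w_p)$ is a complete metric space; (v) $(L_p,\rho^w_p)$ is an $F$-algebra.
   Context: A weight is a Lebesgue measurable function $w:[0,2\pi)\to[0,\infty)$ with $w(t)>0$ for almost every $t$. $L^p$ is the Lebesgue space $L^p([0,2\pi),dt/2\pi)$, and $\log^+a=\max\{\log a,0\}$. For $p>0$ and a weight $w$, $L^w_p$ is the class of all (a.e.-equivalence classes of) complex-valued measurable functions $f$ on $[0,2\pi)$ with $$(\|f\|^w_p)^p:=\int_0^{2\pi}(\log(1+|f(t)|w(t)))^p\,\frac{dt}{2\pi}<\infty,$$ with the translation invariant metric $\rho^w_p(f,g)=(\|f-g\|^w_p)^{\min\{p,1\}}$. For $w\equiv1$ these are denoted $L_p$, $\|\cdot\|_p$ and $\rho_p$; $L_p$ is an algebra under pointwise operations. When $\log^+w\in L^p$ one has $L_p\subset L^w_p$, so $\rho^w_p$ is a metric on $L_p$. An $F$-algebra is a topological algebra (a topological vector space with continuous multiplication) whose topology is given by a complete translation invariant metric; $(L_p,\rho^w_p)$ is an $F$-algebra if this holds with the metric $\rho^w_p$. *)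

(* Defs.v *)
From HB Require Import structures.
From mathcomp Require Import all_boot all_order all_algebra.
From mathcomp Require Import all_classical all_reals all_analysis.
From mathcomp Require Import measurable_realfun.
From mathcomp Require Export complex.

Set Implicit Arguments.
Unset Strict Implicit.
Unset Printing Implicit Defensive.

Import Order.TTheory GRing.Theory Num.Theory numFieldNormedType.Exports.
Import ComplexField.Normc.

Local Open Scope classical_set_scope.
Local Open Scope ring_scope.

Definition circle (R : realType) : Type := {t : R | 0 <= t < 2 * pi}.

Section circle_measure.
Variable R : realType.

Let circle0P : 0 <= (0 : R) < 2 * pi.
Proof. by rewrite lexx mulr_gt0// pi_gt0. Qed.

HB.instance Definition _ := Choice.on (circle R).
HB.instance Definition _ := isPointed.Build (circle R) (exist _ 0 circle0P).

(* R with the complete sigma-algebra of Lebesgue measurable sets, as opposed to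
   the Borel sets carried by R itself. *)
Definition lebesgueType : Type :=
  caratheodory_type (T := ocitv_type R) ((wlength idfun)^*)%mu.
HB.instance Definition _ := Measurable.on lebesgueType.

Definition circle_measurable : set (set (circle R)) :=
  [set A | measurable (val @` A : set lebesgueType)].

Let cset : set R := [set t | 0 <= t < 2 * pi].

Let csetE : cset = [set` `[0, 2 * pi[ ].
Proof. by apply/seteqP; split => t /=; rewrite in_itv. Qed.

Let mcset : measurable (cset : set lebesgueType).
Proof. by rewrite csetE; apply: sub_caratheodory; exact: measurable_itv. Qed.

Let range_val : range (val : circle R -> R) = cset.
Proof.
apply/seteqP; split => [_ [t _ <-]|t ct]; first exact: (valP t).
by exists (exist _ t ct).
Qed.

Let circle_measurable0 : circle_measurable set0.
Proof. by rewrite /circle_measurable/= image_set0; exact: measurable0. Qed.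

Let circle_measurableC A : circle_measurable A -> circle_measurable (~` A).
Proof.
rewrite /circle_measurable/= => mA.
have -> : val @` (~` A) = cset `\` (val @` A) :> set R.
  apply/seteqP; split => [_ [t At <-]|t [ct At]].
    split; first exact: (valP t).
    by move=> [u Au /val_inj ut]; apply: At; rewrite -ut.
  by exists (exist _ t ct) => // Act; apply: At; exists (exist _ t ct).
exact: (@measurableD _ lebesgueType).
Qed.

Let circle_measurable_bigcup (F : (set (circle R))^nat) :
  (forall i, circle_measurable (F i)) -> circle_measurable (\bigcup_i F i).
Proof.
rewrite /circle_measurable/= => mF; rewrite image_bigcup.
by apply: (@bigcupT_measurable _ lebesgueType) => i; exact: mF.
Qed.

HB.instance Definition _ := isMeasurable.Build default_measure_display
  (circle R) circle_measurable0 circle_measurableC circle_measurable_bigcup.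

Definition circle_measure (A : set (circle R)) : \bar R :=
  ((2 * pi)^-1%:E * completed_lebesgue_measure (val @` A))%E.

Let pi2_ge0 : (0 <= (2 * pi)^-1%:E :> \bar R)%E.
Proof. by rewrite lee_fin invr_ge0 mulr_ge0// pi_ge0. Qed.

Let circle_measure0 : circle_measure set0 = 0%E.
Proof. by rewrite /circle_measure image_set0 measure0 mule0. Qed.

Let circle_measure_ge0 A : (0 <= circle_measure A)%E.
Proof. by rewrite mule_ge0. Qed.

Let circle_measure_sigma_additive : semi_sigma_additive circle_measure.
Proof.
move=> F mF tF mUF; rewrite /circle_measure.
rewrite [X in X @ \oo --> _](_ : _ = (fun n => (2 * pi)^-1%:E *
    \sum_(0 <= i < n) completed_lebesgue_measure (val @` F i))%E); last first.
  by apply/funext => k; rewrite ge0_sume_distrr.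
apply: cvgeZl => //; rewrite image_bigcup.
apply: (@measure_semi_sigma_additive _ lebesgueType R
  completed_lebesgue_measure (fun i => val @` F i)).
- exact: mF.
- move=> i j _ _ [_ [[t Ft <-] [u Fu /val_inj ut]]].
  by apply: (tF i j) => //; exists t; split => //; rewrite -ut.
- by rewrite -image_bigcup; exact: mUF.
Qed.

HB.instance Definition _ := isMeasure.Build _ _ _ circle_measure
  circle_measure0 circle_measure_ge0 circle_measure_sigma_additive.

Let circle_measure_setT : circle_measure setT = 1%E.
Proof.
rewrite /circle_measure range_val csetE.
have pi2_gt0 : 0 < 2 * pi :> R by rewrite mulr_gt0// pi_gt0.
rewrite (_ : completed_lebesgue_measure _ =
  lebesgue_measure [set` `[0, 2 * pi[ ])//.
rewrite lebesgue_measure_itv/= lte_fin pi2_gt0 -EFinB subr0 -EFinM.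
by rewrite mulVf// gt_eqF.
Qed.

HB.instance Definition _ :=
  Measure_isProbability.Build _ _ _ circle_measure circle_measure_setT.

End circle_measure.
Arguments circle_measure {R}.

Section complex_measurable.
Variable R : realType.

HB.instance Definition _ := Pointed.copy R[i] R[i]^o.

(* The Borel sets of C, with C identified with R * R. *)
Definition complex_measurable : set (set R[i]) :=
  [set A | measurable [set xy : R * R | A (xy.1 +i* xy.2)%C] ].

Let complex_measurable0 : complex_measurable set0.
Proof. exact: measurable0. Qed.

Let complex_measurableC A : complex_measurable A -> complex_measurable (~` A).
Proof. by move=> mA; exact: measurableC. Qed.

Let complex_measurable_bigcup (F : (set R[i])^nat) :
  (forall i, complex_measurable (F i)) -> complex_measurable (\bigcup_i F i).
Proof. by move=> mF; exact: bigcupT_measurable. Qed.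

HB.instance Definition _ := isMeasurable.Build default_measure_display
  R[i] complex_measurable0 complex_measurableC complex_measurable_bigcup.

Lemma measurable_Re : measurable_fun [set: R[i]] (@complex.Re R).
Proof.
move=> _ Y mY; rewrite setTI /measurable/= /complex_measurable/=.
by rewrite -[X in measurable X]setTI; apply: measurable_fst.
Qed.

Lemma measurable_Im : measurable_fun [set: R[i]] (@complex.Im R).
Proof.
move=> _ Y mY; rewrite setTI /measurable/= /complex_measurable/=.
by rewrite -[X in measurable X]setTI; apply: measurable_snd.
Qed.

Lemma measurable_complexP d (T : measurableType d) (f : T -> R[i]) :
  measurable_fun setT f <->
  measurable_fun setT (fun t => complex.Re (f t)) /\
  measurable_fun setT (fun t => complex.Im (f t)).
Proof.
split=> [mf|[mr mi] _ Y mY].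
  split; first exact: (measurableT_comp measurable_Re).
  exact: (measurableT_comp measurable_Im).
have := measurable_fun_pair mr mi measurableT mY.
by rewrite !setTI; congr measurable; apply/seteqP; split => t /=; case: (f t).
Qed.

Lemma measurable_normc : measurable_fun [set: R[i]] (@normc R).
Proof.
have -> : @normc R = fun z : R[i] =>
    (complex.Re z ^+ 2 + complex.Im z ^+ 2) `^ 2^-1.
  by apply/funext => -[a b]; rewrite /= powR12_sqrt// addr_ge0// sqr_ge0.
apply: (measurableT_comp (@measurable_powR R 2^-1)).
apply: measurable_funD; apply: measurable_funX.
  exact: measurable_Re.
exact: measurable_Im.
Qed.

End complex_measurable.

Section L0.
Context d (T : measurableType d) (R : realType) (P : probability T R).
Implicit Types u v : {mfun T >-> R[i]}.

Definition L0 : Type := {mfun_ P, T >-> R[i]}.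
HB.instance Definition _ := Choice.on L0.
Definition L0_fun (f : L0) : T -> R[i] := repr f.
Coercion L0_fun : L0 >-> Funclass.

Definition L0_class u : L0 := \pi_{mfun_ P, T >-> R[i]}%qT u.

Lemma L0_classE u : L0_class u = u %[ae P].
Proof.
have /eqmodP/asboolP := reprK (L0_class u).
by [].
Qed.

Lemma L0_eqP (f g : L0) : f = g %[ae P] -> f = g.
Proof.
move=> fg; rewrite -(reprK (f : {mfun_ P, T >-> R[i]})).
rewrite -(reprK (g : {mfun_ P, T >-> R[i]})).
by apply/eqmodP/asboolP.
Qed.

Lemma measurable_L0 (f : L0) : measurable_fun setT f.
Proof. exact: measurable_funPT. Qed.

Let mfun_of (u : T -> R[i]) (mu : measurable_fun setT u) : {mfun T >-> R[i]} :=
  mfun_Sub (mem_set mu).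

Let add_subproof u v : measurable_fun setT (u \+ v).
Proof.
have [ur ui] := (measurable_complexP u).1 (measurable_funPT u).
have [vr vi] := (measurable_complexP v).1 (measurable_funPT v).
apply/measurable_complexP; split.
  rewrite (_ : (fun _ => _) = (fun t => complex.Re (u t) + complex.Re (v t))).
    exact: measurable_funD.
  by apply/funext => t /=; case: (u t); case: (v t).
rewrite (_ : (fun _ => _) = (fun t => complex.Im (u t) + complex.Im (v t))).
  exact: measurable_funD.
by apply/funext => t /=; case: (u t); case: (v t).
Qed.

Let mul_subproof u v : measurable_fun setT (u \* v).
Proof.
have [ur ui] := (measurable_complexP u).1 (measurable_funPT u).
have [vr vi] := (measurable_complexP v).1 (measurable_funPT v).
apply/measurable_complexP; split.
  rewrite (_ : (fun _ => _) = (fun t =>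
      complex.Re (u t) * complex.Re (v t) -
      complex.Im (u t) * complex.Im (v t))).
    by apply: measurable_funB; exact: measurable_funM.
  by apply/funext => t /=; case: (u t); case: (v t).
rewrite (_ : (fun _ => _) = (fun t =>
    complex.Re (u t) * complex.Im (v t) +
    complex.Im (u t) * complex.Re (v t))).
  by apply: measurable_funD; exact: measurable_funM.
by apply/funext => t /=; case: (u t); case: (v t).
Qed.

Let cst_mfun (c : R[i]) : {mfun T >-> R[i]} :=
  mfun_of (measurable_cst c : measurable_fun setT (fun=> c)).
Let mulM u v : {mfun T >-> R[i]} := mfun_of (mul_subproof u v).

Definition L0_cst (c : R[i]) : L0 := L0_class (cst_mfun c).
Definition L0_add (f g : L0) : L0 :=
  L0_class (mfun_of (add_subproof (repr f) (repr g))).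
Definition L0_mul (f g : L0) : L0 := L0_class (mulM (repr f) (repr g)).
Definition L0_scale (c : R[i]) (f : L0) : L0 :=
  L0_class (mulM (cst_mfun c) (repr f)).

Let cstE c : L0_cst c = (fun=> c) %[ae P]. Proof. exact: L0_classE. Qed.
Let addE f g : L0_add f g = f \+ g %[ae P]. Proof. exact: L0_classE. Qed.
Let mulE f g : L0_mul f g = f \* g %[ae P]. Proof. exact: L0_classE. Qed.
Let scaleE c f : L0_scale c f = (fun t => c * f t) %[ae P].
Proof. exact: L0_classE. Qed.

Let addA : associative L0_add.
Proof.
move=> f g h; apply: L0_eqP.
apply: filterS (filterI (addE f (L0_add g h))
  (filterI (addE g h)
  (filterI (addE (L0_add f g) h) (addE f g))))
  => t [] e1 [] e2 [] e3 e4.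
by move: e1 e2 e3 e4 =>
  /= /(_ I)-> /= /(_ I)-> /(_ I)-> /= /(_ I)-> _ /=; rewrite addrA.
Qed.

Let addC : commutative L0_add.
Proof.
move=> f g; apply: L0_eqP.
apply: filterS (filterI (addE f g) (addE g f))
  => t [] e1 e2.
by move: e1 e2 => /= /(_ I)-> /(_ I)-> _ /=; rewrite addrC.
Qed.

Let add0 : left_id (L0_cst 0) L0_add.
Proof.
move=> f; apply: L0_eqP.
apply: filterS (filterI (addE (L0_cst 0) f) (cstE 0))
  => t [] e1 e2.
by move: e1 e2 => /= /(_ I)-> /= /(_ I)-> _ /=; rewrite add0r.
Qed.

Let addN : left_inverse (L0_cst 0) (L0_scale (-1)) L0_add.
Proof.
move=> f; apply: L0_eqP.
apply: filterS (filterI (addE (L0_scale (-1) f) f)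
  (filterI (cstE 0) (scaleE (-1) f)))
  => t [] e1 [] e2 e3.
by move: e1 e2 e3 =>
  /= /(_ I)-> /= /(_ I)-> /(_ I)-> _ /=; rewrite mulN1r addNr.
Qed.

HB.instance Definition _ := GRing.isZmodule.Build L0 addA addC add0 addN.

Let mulA : associative L0_mul.
Proof.
move=> f g h; apply: L0_eqP.
apply: filterS (filterI (mulE f (L0_mul g h))
  (filterI (mulE g h)
  (filterI (mulE (L0_mul f g) h) (mulE f g))))
  => t [] e1 [] e2 [] e3 e4.
by move: e1 e2 e3 e4 =>
  /= /(_ I)-> /= /(_ I)-> /(_ I)-> /= /(_ I)-> _ /=; rewrite mulrA.
Qed.

Let mulC : commutative L0_mul.
Proof.
move=> f g; apply: L0_eqP.
apply: filterS (filterI (mulE f g) (mulE g f))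
  => t [] e1 e2.
by move: e1 e2 => /= /(_ I)-> /(_ I)-> _ /=; rewrite mulrC.
Qed.

Let mul1 : left_id (L0_cst 1) L0_mul.
Proof.
move=> f; apply: L0_eqP.
apply: filterS (filterI (mulE (L0_cst 1) f) (cstE 1))
  => t [] e1 e2.
by move: e1 e2 => /= /(_ I)-> /= /(_ I)-> _ /=; rewrite mul1r.
Qed.

Let mulDl : left_distributive L0_mul L0_add.
Proof.
move=> f g h; apply: L0_eqP.
apply: filterS (filterI (mulE (L0_add f g) h)
  (filterI (addE f g)
  (filterI (addE (L0_mul f h) (L0_mul g h))
  (filterI (mulE f h) (mulE g h)))))
  => t [] e1 [] e2 [] e3 [] e4 e5.
move: e1 e2 e3 e4 e5 =>
  /= /(_ I)-> /= /(_ I)-> /(_ I)-> /= /(_ I)-> /(_ I)-> _ /=.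
by rewrite mulrDl.
Qed.

Let L0_oner_neq0 : L0_cst 1 != L0_cst 0.
Proof.
apply/eqP => e10; have : \forall t \ae P, False.
  apply: filterS (filterI (cstE 1) (cstE 0)) => t [] e1 e2.
by move: e1 e2 => /= /(_ I); rewrite e10 => -> /(_ I) /eqP; rewrite oner_eq0.
move=> [N [_ PN0 /(_ _ _)/= NT]].
have NE : N = setT by apply/seteqP; split => // t _; exact: NT.
by move: PN0; rewrite NE probability_setT => /eqP; rewrite onee_eq0.
Qed.

HB.instance Definition _ := GRing.Zmodule_isComNzRing.Build L0
  mulA mulC mul1 mulDl L0_oner_neq0.

Let scaleA a b f : L0_scale a (L0_scale b f) = L0_scale (a * b) f.
Proof.
apply: L0_eqP.
apply: filterS (filterI (scaleE a (L0_scale b f))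
  (filterI (scaleE b f) (scaleE (a * b) f)))
  => t [] e1 [] e2 e3.
by move: e1 e2 e3 => /= /(_ I)-> /(_ I)-> /(_ I)-> _; rewrite mulrA.
Qed.

Let scale1 : left_id 1 L0_scale.
Proof.
move=> f; apply: L0_eqP; apply: filterS (scaleE 1 f) => t e1.
by move: e1 => /= /(_ I)-> _; rewrite mul1r.
Qed.

Let scaleDr : right_distributive L0_scale +%R.
Proof.
move=> c f g; apply: L0_eqP.
apply: filterS (filterI (scaleE c (L0_add f g))
  (filterI (addE f g)
  (filterI (addE (L0_scale c f) (L0_scale c g))
  (filterI (scaleE c f) (scaleE c g)))))
  => t [] e1 [] e2 [] e3 [] e4 e5.
move: e1 e2 e3 e4 e5 => /= /(_ I)-> /(_ I)-> /(_ I)-> /= /(_ I)-> /(_ I)-> _ /=.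
by rewrite mulrDr.
Qed.

Let scaleDl f : {morph L0_scale^~ f : a b / a + b}.
Proof.
move=> a b; apply: L0_eqP.
apply: filterS (filterI (scaleE (a + b) f)
  (filterI (addE (L0_scale a f) (L0_scale b f))
  (filterI (scaleE a f) (scaleE b f))))
  => t [] e1 [] e2 [] e3 e4.
by move: e1 e2 e3 e4 =>
  /= /(_ I)-> /(_ I)-> /= /(_ I)-> /(_ I)-> _ /=; rewrite mulrDl.
Qed.

HB.instance Definition _ := GRing.Zmodule_isLmodule.Build R[i] L0
  scaleA scale1 scaleDr scaleDl.

Let scaleAl (a : R[i]) (f g : L0) : a *: (f * g) = (a *: f) * g.
Proof.
apply: L0_eqP.
apply: filterS (filterI (scaleE a (L0_mul f g))
  (filterI (mulE f g)
  (filterI (mulE (L0_scale a f) g) (scaleE a f))))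
  => t [] e1 [] e2 [] e3 e4.
by move: e1 e2 e3 e4 =>
  /= /(_ I)-> /(_ I)-> /(_ I)-> /= /(_ I)-> _ /=; rewrite mulrA.
Qed.

HB.instance Definition _ := GRing.Lmodule_isLalgebra.Build R[i] L0 scaleAl.
HB.instance Definition _ := GRing.Lalgebra_isComAlgebra.Build R[i] L0.

Lemma L0_cst0E : (0 : L0) = (fun=> 0) %[ae P]. Proof. exact: cstE. Qed.
Lemma L0_cst1E : (1 : L0) = (fun=> 1) %[ae P]. Proof. exact: cstE. Qed.
Lemma L0_addE (f g : L0) : (f + g : L0) = f \+ g %[ae P].
Proof. exact: addE. Qed.
Lemma L0_mulE (f g : L0) : (f * g : L0) = f \* g %[ae P].
Proof. exact: mulE. Qed.
Lemma L0_scaleE c (f : L0) : (c *: f : L0) = (fun t => c * f t) %[ae P].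
Proof. exact: scaleE. Qed.

End L0.

Section logint.
Context d (T : measurableType d) (R : realType) (P : probability T R).

(* Since [ln x = 0] for [x <= 0], [ln (w t)] and [Num.max (ln (w t)) 0] have
   their usual values outside of the null set where [w] vanishes. *)
Definition is_weight (w : T -> R) : Prop :=
  [/\ measurable_fun setT w, (forall t, 0 <= w t) & {ae P, forall t, 0 < w t}].

Definition logint (p : R) (w : T -> R) (f : T -> R[i]) : \bar R :=
  (\int[P]_t (ln (1 + normc (f t) * w t) `^ p)%:E)%E.

Definition lognorm p w f : \bar R := (logint p w f `^ p^-1)%E.

Definition Lw p w : set (L0 P) := [set f : L0 P | logint p w f < +oo]%E.

(* Meaningful only when f - g is in L^w_p, since [fine] sends +oo to 0. *)
Definition rho_w p w (f g : L0 P) : R :=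
  fine (lognorm p w (f - g : L0 P)) `^ Num.min p 1.

End logint.
Arguments logint {d T R} P p w f.
Arguments lognorm {d T R} P p w f.
Arguments Lw {d T R} P p w.
Arguments rho_w {d T R P} p w f g.

Section Lp.
Context d (T : measurableType d) (R : realType) (P : probability T R).
Variables (p : R) (p0 : 0 < p).

Let w1 : T -> R := cst 1.
Let lg (f : T -> R[i]) (t : T) : R := ln (1 + normc (f t) * w1 t).

Let normc_ge0 (z : R[i]) : 0 <= normc z.
Proof. by case: z => a b; rewrite sqrtr_ge0. Qed.

Let lg_ge0 f t : 0 <= lg f t.
Proof. by rewrite ln_ge0// lerDl mulr_ge0. Qed.

Let measurable_lg f : measurable_fun setT f -> measurable_fun setT (lg f).
Proof.
move=> mf; apply: measurableT_comp => //; apply: measurable_funD => //.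
apply: measurable_funM => //.
exact: (measurableT_comp (@measurable_normc R)).
Qed.

Let measurable_lgp f : measurable_fun setT f ->
  measurable_fun setT (fun t => (lg f t `^ p)%:E).
Proof.
move=> mf; apply/measurable_EFinP.
by apply: (measurableT_comp (@measurable_powR R p)); exact: measurable_lg.
Qed.

Let logint_ltyD (f g h : L0 P) :
  {ae P, forall t, lg h t <= lg f t + lg g t} ->
  Lw P p w1 f -> Lw P p w1 g -> Lw P p w1 h.
Proof.
move=> hfg Lf Lg.
have If : (\int[P]_t (lg f t `^ p)%:E < +oo)%E := Lf.
have Ig : (\int[P]_t (lg g t `^ p)%:E < +oo)%E := Lg.
suff : (\int[P]_t (lg h t `^ p)%:E < +oo)%E by [].
move: {Lf Lg} If Ig => If Ig.
have p_ge0 := ltW p0.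
pose F t := ((2 `^ p)%:E * ((lg f t `^ p)%:E + (lg g t `^ p)%:E))%E.
have mf := measurable_lgp (measurable_L0 f).
have mg := measurable_lgp (measurable_L0 g).
have mF : measurable_fun setT F.
  exact: measurable_funeM (emeasurable_funD mf mg).
have F0 t : (0 <= F t)%E by rewrite mule_ge0 ?adde_ge0 ?lee_fin ?powR_ge0.
apply: (@le_lt_trans _ _ (\int[P]_t F t)%E).
  apply: ae_ge0_le_integral => //.
  - by move=> t _; rewrite lee_fin powR_ge0.
  - exact: measurable_lgp (measurable_L0 h).
  apply: filterS hfg => t le_h _; rewrite /F -EFinD -EFinM lee_fin.
  set a := lg f t in le_h *; set b := lg g t in le_h *.
  have a0 : 0 <= a := lg_ge0 f t; have b0 : 0 <= b := lg_ge0 g t.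
  have m0 : 0 <= Num.max a b by rewrite le_max a0.
  apply: (@le_trans _ _ ((2 * Num.max a b) `^ p)).
    apply: ge0_ler_powR; rewrite ?nnegrE ?mulr_ge0 ?lg_ge0//.
    by rewrite (le_trans le_h)// mulr_natl mulr2n lerD// le_max lexx ?orbT.
  rewrite powRM// ler_wpM2l ?powR_ge0//.
  by case: (leP a b) => _; rewrite ?lerDl ?lerDr powR_ge0.
rewrite ge0_integralZl//; last 2 first.
- exact: emeasurable_funD mf mg.
- by move=> t _; rewrite adde_ge0 ?lee_fin ?powR_ge0.
rewrite ge0_integralD//.
- apply: lte_mul_pinfty; [by rewrite lee_fin powR_ge0|by []|].
  exact: lte_add_pinfty If Ig.
- by move=> t _; rewrite lee_fin powR_ge0.
- by move=> t _; rewrite lee_fin powR_ge0.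
Qed.

Let lnD1 (a b c : R) : 0 <= a -> 0 <= b -> 0 <= c -> c <= a + b + a * b ->
  ln (1 + c) <= ln (1 + a) + ln (1 + b).
Proof.
move=> a0 b0 c0 cab; rewrite -lnM ?posrE ?ltr_wpDr//.
rewrite ler_ln ?posrE ?mulr_gt0 ?ltr_wpDr//.
rewrite mulrDl mul1r mulrDr mulr1 -!addrA lerD2l.
by rewrite (le_trans cab)// addrCA addrA.
Qed.

Let LwD (f g : L0 P) : Lw P p w1 f -> Lw P p w1 g -> Lw P p w1 (f + g).
Proof.
apply: logint_ltyD; apply: filterS (L0_addE f g) => t /(_ Logic.I) fgt.
rewrite /lg fgt /= !mulr1; apply: lnD1 => //.
by rewrite (le_trans (le_normcD _ _))// lerDl mulr_ge0.
Qed.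

Let LwM (f g : L0 P) : Lw P p w1 f -> Lw P p w1 g -> Lw P p w1 (f * g).
Proof.
apply: logint_ltyD; apply: filterS (L0_mulE f g) => t /(_ Logic.I) fgt.
rewrite /lg fgt /= !mulr1 normcM.
by apply: lnD1; rewrite ?mulr_ge0// lerDr addr_ge0.
Qed.

Let Lw_cst (f : L0 P) c : f = (fun=> c) %[ae P] -> Lw P p w1 f.
Proof.
move=> fc; have P1 : (P : {measure set T -> \bar R}) setT = 1%E by
  exact: probability_setT.
suff : (\int[P]_t (lg f t `^ p)%:E < +oo)%E by [].
rewrite (ge0_ae_eq_integral (g := fun=> (ln (1 + normc c * 1) `^ p)%:E))//.
- by rewrite integral_cst// P1 mule1 ltry.
- exact: measurable_lgp (measurable_L0 f).
- by move=> t _; rewrite lee_fin powR_ge0.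
- by move=> t _; rewrite lee_fin powR_ge0.
- by apply: filterS fc => t /(_ Logic.I) fct _; rewrite /lg fct.
Qed.

(* The proof of 0 < p is a parameter so that the closure properties below, which
   need it, can be attached to the predicate. *)
Definition in_Lp of 0 < p : pred (L0 P) := fun f => `[< Lw P p (cst 1) f >].

Lemma in_LpP f : reflect (Lw P p (cst 1) f) (f \in in_Lp p0).
Proof. exact: asboolP. Qed.

Let in_Lp_subalg : GRing.subsemialg_closed (in_Lp p0).
Proof.
split.
- by apply/in_LpP; apply: Lw_cst; exact: L0_cst1E.
- split; first by apply/in_LpP; apply: Lw_cst; exact: L0_cst0E.
  by move=> f g /in_LpP Lf /in_LpP Lg; apply/in_LpP; exact: (LwD Lf Lg).
- move=> c f /in_LpP Lf; apply/in_LpP.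
  have -> : c *: f = (c *: 1) * f by rewrite -scalerAl mul1r.
  apply: (LwM _ Lf); apply: (@Lw_cst _ c).
  apply: filterS (filterI (L0_scaleE c (1 : L0 P)) (L0_cst1E P)) => t [] e1 e2.
  by move: e1 e2 => /= /(_ Logic.I)-> /(_ Logic.I)-> _; rewrite mulr1.
- by move=> f g /in_LpP Lf /in_LpP Lg; apply/in_LpP; exact: (LwM Lf Lg).
Qed.

HB.instance Definition _ :=
  GRing.isSubalgClosed.Build R[i] (L0 P) (in_Lp p0) in_Lp_subalg.

Record Lp : Type := MkLp { Lp_val :> L0 P ; _ : Lp_val \in in_Lp p0 }.
HB.instance Definition _ := [isSub for Lp_val].
HB.instance Definition _ := [Choice of Lp by <:].
HB.instance Definition _ := [SubChoice_isSubAlgebra of Lp by <:].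

Definition rho_Lp (w : T -> R) (f g : Lp) : R := rho_w p w f g.

End Lp.

Record is_metric (R : realType) (M : Type) (dist : M -> M -> R) : Prop :=
  IsMetric {
    dist_xx : forall x, dist x x = 0 ;
    dist_positivity : forall x y, dist x y = 0 -> x = y ;
    dist_sym : forall x y, dist x y = dist y x ;
    dist_triangle : forall y x z, dist x z <= dist x y + dist y z }.

(* M with the uniform structure and the topology of the metric dist, as
   provided by the factory [isMetric]. *)
Definition metrized (R : realType) (M : choiceType) (dist : M -> M -> R)
  of is_metric dist : Type := M.

Section metrized.
Context (R : realType) (M : choiceType) (dist : M -> M -> R).
Variable h : is_metric dist.

HB.instance Definition _ := Choice.on (metrized h).
HB.instance Definition _ := isMetric.Build R (metrized h)
  (dist_xx h) (dist_positivity h) (dist_sym h) (dist_triangle h).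

End metrized.

Definition same_topology (R : realType) (M : choiceType)
    (dist1 dist2 : M -> M -> R) : Prop :=
  exists (h1 : is_metric dist1) (h2 : is_metric dist2),
    forall U : set M,
      open (U : set (metrized h1)) <-> open (U : set (metrized h2)).

Definition cauchy_complete (R : realType) (M : choiceType)
    (dist : M -> M -> R) (h : is_metric dist) : Prop :=
  forall u : nat -> metrized h,
    cauchy (u @ \oo) -> exists l : metrized h, u @ \oo --> l.

Definition complete_metric_space (R : realType) (M : choiceType)
    (dist : M -> M -> R) : Prop :=
  exists h : is_metric dist, cauchy_complete h.

Definition F_algebra (R : realType) (K : numFieldType) (A : algType K)
    (dist : A -> A -> R) : Prop :=
  exists h : is_metric dist, let X := metrized h in
  [/\ cauchy_complete h,
      (forall x y z : A, dist (x + z) (y + z) = dist x y),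
      continuous ((fun x => (x.1 : A) + (x.2 : A)) : X * X -> X),
      continuous ((fun x => x.1 *: (x.2 : A)) : K^o * X -> X) &
      continuous ((fun x => (x.1 : A) * (x.2 : A)) : X * X -> X)].

(* Main.v *)
Require Import Defs.
From mathcomp Require Import all_boot all_order all_algebra.
From mathcomp Require Import all_classical all_reals all_analysis.
From mathcomp Require Import measurable_realfun ring lra.
Import Order.TTheory GRing.Theory Num.Theory numFieldNormedType.Exports.
Import ComplexField.Normc.
Local Open Scope classical_set_scope.
Local Open Scope ring_scope.

Set Implicit Arguments.
Unset Strict Implicit.
Unset Printing Implicit Defensive.

(* Write N_v f for the L^p norm of log(1+|f|v). Each of the five statements
   amounts to log(1+1/w) in L^p. The pointwise bound
     log(1+|f|v) <= (n+1) log(1+|f|) + 1_{v>n} log(1+v),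
   whose last term tends to 0 in L^p when log(1+v) is in L^p, shows that N_v is
   then continuous with respect to N_1. With v = w and v = 1/w it gives the
   equality of the two topologies, and with v = |g| the continuity of
   multiplication by g. Equal topologies force completeness, because both
   metrics are translation invariant and rho_p is complete. Finally the
   functions min(1/w,n) in L_p always form a rho_w-Cauchy sequence that tends to
   1/w, so completeness of rho_w puts 1/w in L_p. *)

(** * Elementary inequalities for ln (1 + x) *)

Section ln1D.
Context {R : realType}.
Implicit Types x y v : R.

Lemma ln1D_ge0 x : 0 <= x -> 0 <= ln (1 + x).
Proof. by move=> x0; rewrite ln_ge0// lerDl. Qed.

Lemma ler_ln1D x y : 0 <= x -> x <= y -> ln (1 + x) <= ln (1 + y).
Proof.
move=> x0 xy; rewrite ler_ln ?posrE ?lerD2l// ltr_wpDr//.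
exact: le_trans xy.
Qed.

(** This is the expansion of (1 + x)(1 + y). Dropping x y, respectively x + y, from it gives the
    next two lemmas. *)
Lemma ln1DM x y : 0 <= x -> 0 <= y ->
  ln (1 + (x + y + x * y)) = ln (1 + x) + ln (1 + y).
Proof.
move=> x0 y0; rewrite -lnM ?posrE ?ltr_wpDr//; congr ln.
by rewrite mulrDl mul1r mulrDr mulr1 -!addrA; congr (_ + _); rewrite addrCA.
Qed.

Lemma ler_ln1D_add x y : 0 <= x -> 0 <= y ->
  ln (1 + (x + y)) <= ln (1 + x) + ln (1 + y).
Proof.
move=> x0 y0; rewrite -ln1DM// ler_ln1D ?addr_ge0// lerDl.
exact: mulr_ge0.
Qed.

Lemma ler_ln1D_mul x y : 0 <= x -> 0 <= y ->
  ln (1 + x * y) <= ln (1 + x) + ln (1 + y).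
Proof.
move=> x0 y0; rewrite -ln1DM// ler_ln1D ?mulr_ge0// lerDr.
exact: addr_ge0.
Qed.

Lemma ler_ln1D_mulrn n x : 0 <= x -> ln (1 + x *+ n) <= ln (1 + x) *+ n.
Proof.
move=> x0; elim: n => [|n IH]; first by rewrite !mulr0n addr0 ln1.
rewrite !mulrSr (le_trans (ler_ln1D_add _ _))// ?lerD2r//.
exact: mulrn_wge0.
Qed.

(** Where v <= n, x v is at most (n + 1) x, and ln (1 + (n + 1) x) <= (n + 1) ln (1 + x). Where v >
    n, submultiplicativity uses one copy of ln (1 + x); having n + 1 copies rather than n keeps the
    bound valid at n = 0. *)
Lemma ler_ln1D_split n x v : 0 <= x -> 0 <= v ->
  ln (1 + x * v) <= ln (1 + x) *+ n.+1 + (if n%:R < v then ln (1 + v) else 0).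
Proof.
move=> x0 v0; case: ltP => [nv|vn].
  rewrite (le_trans (ler_ln1D_mul x0 v0))// lerD2r mulrSr lerDr.
  by rewrite mulrn_wge0// ln1D_ge0.
rewrite addr0 (le_trans _ (ler_ln1D_mulrn _ x0))// ler_ln1D ?mulr_ge0//.
rewrite -mulr_natr ler_wpM2l// (le_trans vn)// ler_nat//.
Qed.

(** 1 + x is at most 2 for x <= 1 and at most 2 x for x > 1. *)
Lemma ler_ln1D_max x : 0 <= x -> ln (1 + x) <= ln 2 + Num.max (ln x) 0.
Proof.
move=> x0; have [x1|x1] := leP x 1.
  rewrite ler_wpDr ?le_max ?lexx ?orbT// ler_ln ?posrE ?ltr_wpDr//.
  by rewrite -[leRHS]/(1 + 1) lerD2l.
have x_gt0 : 0 < x by exact: lt_trans x1.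
rewrite (@le_trans _ _ (ln 2 + ln x))// ?lerD2l ?le_max ?lexx//.
rewrite -lnM ?posrE// ler_ln ?posrE ?ltr_wpDr ?mulr_gt0//.
by rewrite mulrDl mul1r lerD2r ltW.
Qed.

(** If ln x < 0, then |ln x| = ln (1/x), which the second summand dominates. *)
Lemma norm_ln_le x : 0 <= x ->
  `|ln x| <= Num.max (ln x) 0 + ln (1 + x^-1).
Proof.
rewrite le_eqVlt => /predU1P[<-|x0].
  (* With the default values [ln 0 = 0] and [0^-1 = 0], both sides vanish at x = 0. *)
  by rewrite !(ln0 (lexx _)) normr0 invr0 addr0 ln1 addr0 maxxx.
have xV0 : 0 < x^-1 by rewrite invr_gt0.
have [lx|lx] := leP 0 (ln x).
  by rewrite ger0_norm// lerDl ln1D_ge0// ltW.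
rewrite ltr0_norm// add0r -lnV ?posrE// ler_ln ?posrE//.
- by rewrite lerDr.
- by rewrite ltr_wpDr// ltW.
Qed.

(** For x > 0 this is [ler_ln1D_max] at 1/x: the positive part of ln (1/x) = - ln x is at most |ln
    x|. *)
Lemma ler_ln1DV x : 0 <= x -> ln (1 + x^-1) <= ln 2 + `|ln x|.
Proof.
rewrite le_eqVlt => /predU1P[<-|x0].
  by rewrite (ln0 (lexx _)) normr0 invr0 addr0 ln1 addr0 ln_ge0// ler1n.
have xV0 : 0 <= x^-1 by rewrite invr_ge0 ltW.
apply: le_trans (ler_ln1D_max xV0) _; rewrite lerD2l lnV ?posrE//.
by rewrite ge_max -normrN ler_norm normr_ge0.
Qed.

End ln1D.

(** * L^p norms of real functions against integrals of p-th powers *)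

Section Lnorm_extra.
Context d (T : measurableType d) (R : realType).
Variable P : {measure set T -> \bar R}.
Variables (p : R).
Hypothesis p1 : 1 <= p.
Implicit Types f g : T -> R.

Local Notation "'N[ f ]" := ('N[P]_p%:E [EFin \o f])%E.

Let p0 : 0 < p. Proof. exact: lt_le_trans p1. Qed.
Let pN0 : p != 0. Proof. by rewrite gt_eqF. Qed.

Lemma measurable_powR_norm f : measurable_fun setT f ->
  measurable_fun setT (fun t => (`|f t| `^ p)%:E).
Proof.
move=> mf; apply/measurable_EFinP.
by apply: (measurableT_comp (@measurable_powR R p)); exact: measurableT_comp.
Qed.

Lemma powR_LnormE f : ('N[f] `^ p = \int[P]_t (`|f t| `^ p)%:E)%E.
Proof. by rewrite powR_Lnorm. Qed.

Let integral_powR_ge0 f : (0 <= \int[P]_t (`|f t| `^ p)%:E)%E.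
Proof. by apply: integral_ge0 => t _; rewrite lee_fin powR_ge0. Qed.

Lemma Lnorm_ae_le f g : measurable_fun setT f -> measurable_fun setT g ->
  {ae P, forall t, `|f t| <= `|g t|} -> ('N[f] <= 'N[g])%E.
Proof.
move=> mf mg fg; rewrite unlock /=; apply: gt0_ler_poweR.
- by rewrite invr_ge0 ltW.
- by rewrite in_itv/= leey andbT; exact: integral_powR_ge0.
- by rewrite in_itv/= leey andbT; exact: integral_powR_ge0.
apply: ae_ge0_le_integral => //.
- exact: measurable_powR_norm.
- exact: measurable_powR_norm.
apply: filterS fg => t fgt _; rewrite lee_fin.
by rewrite ge0_ler_powR ?nnegrE// ltW.
Qed.

Lemma Lnorm_lt_integral f e : 0 < e ->
  (\int[P]_t (`|f t| `^ p)%:E < (e `^ p)%:E)%E -> ('N[f] < e%:E)%E.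
Proof.
move=> e0; rewrite -powR_LnormE; apply: contraTT; rewrite -!leNgt => ef.
rewrite -poweR_EFin; apply: gt0_ler_poweR => //; rewrite ?in_itv/= ?leey ?andbT.
- exact: ltW.
- by rewrite lee_fin ltW.
- exact: Lnorm_ge0.
Qed.

Lemma Lnorm_le_integral f e : 0 <= e ->
  (\int[P]_t (`|f t| `^ p)%:E <= (e `^ p)%:E)%E -> ('N[f] <= e%:E)%E.
Proof.
move=> e0; rewrite unlock/= => fe.
have -> : e%:E = ((e `^ p)%:E `^ p^-1)%E.
  by rewrite poweR_EFin -powRrM mulfV// powRr1.
apply: gt0_ler_poweR; rewrite ?in_itv/= ?leey ?andbT//.
- by rewrite invr_ge0 ltW.
- by rewrite lee_fin powR_ge0.
Qed.

Lemma integral_Lnorm_lt f e : 0 < e -> ('N[f] < e%:E)%E ->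
  (\int[P]_t (`|f t| `^ p)%:E <= (e `^ p)%:E)%E.
Proof.
move=> e0 fe; rewrite -powR_LnormE -poweR_EFin.
apply: gt0_ler_poweR; rewrite ?in_itv/= ?leey ?andbT//.
- exact: ltW.
- exact: Lnorm_ge0.
- by rewrite lee_fin ltW.
- exact: ltW.
Qed.

Lemma Lfun_lty f : measurable_fun setT f ->
  (f \in Lfun P p%:E) = ('N[f] < +oo)%E.
Proof.
move=> mf; apply/idP/idP => [|Nf].
  by rewrite inE => /andP[_]; rewrite inE.
by rewrite inE; apply/andP; split; rewrite inE.
Qed.

Lemma Lnorm_natmul f n : measurable_fun setT f ->
  ('N[(fun t => f t *+ n)%R] <= 'N[f] *+ n)%E.
Proof.
move=> mf; elim: n => [|n IH].
  rewrite mule0n (_ : (fun _ => _) = cst 0).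
    by rewrite (_ : EFin \o _ = cst 0%E)// Lnorm0// eqe.
  by apply/funext => t; rewrite mulr0n.
rewrite (_ : (fun _ => _) = f \+ (fun t => f t *+ n)); last first.
  by apply/funext => t; rewrite mulrS.
rewrite muleS (le_trans (minkowski_EFin _ _ _ _))//.
  under eq_fun do rewrite -mulr_natr; exact: measurable_funM.
by rewrite leeD2l.
Qed.

End Lnorm_extra.

(** * The L^p norm of ln (1 + h) *)

Section lnL.
Context d (T : measurableType d) (R : realType) (P : probability T R).
Variables (p : R).
Hypothesis p1 : 1 <= p.
Implicit Types f g h k l v : T -> R.

Local Notation "'N[ f ]" := ('N[P]_p%:E [EFin \o f])%E.

(** At h = |f| v this is the norm of f in L^v_p. Taking a real function as argument lets it apply to
    w and 1/w themselves as well. *)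
Definition lnL h : \bar R := 'N[fun t => ln (1 + h t)].

Let p0 : 0 < p. Proof. exact: lt_le_trans p1. Qed.

Lemma measurable_ln1D h : measurable_fun setT h ->
  measurable_fun setT (fun t => ln (1 + h t)).
Proof. by move=> mh; apply: measurableT_comp => //; exact: measurable_funD. Qed.

Lemma lnL_ae_le h k : measurable_fun setT h -> measurable_fun setT k ->
  (forall t, 0 <= h t) -> {ae P, forall t, h t <= k t} -> (lnL h <= lnL k)%E.
Proof.
move=> mh mk h0 hk; apply: (Lnorm_ae_le p1); try exact: measurable_ln1D.
apply: filterS hk => t hkt; have k0 := le_trans (h0 t) hkt.
by rewrite !ger0_norm ?ln1D_ge0 ?ler_ln1D.
Qed.

Lemma lnL_ae_eq h k : measurable_fun setT h -> measurable_fun setT k ->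
  (forall t, 0 <= h t) -> (forall t, 0 <= k t) ->
  {ae P, forall t, h t = k t} -> lnL h = lnL k.
Proof.
move=> mh mk h0 k0 hk; apply/eqP; rewrite eq_le; apply/andP; split.
  by apply: lnL_ae_le => //; apply: filterS hk => t ->.
by apply: lnL_ae_le => //; apply: filterS hk => t ->.
Qed.

Lemma lnL_le_add h k l : measurable_fun setT h -> measurable_fun setT k ->
  measurable_fun setT l ->
  (forall t, 0 <= h t) -> (forall t, 0 <= k t) -> (forall t, 0 <= l t) ->
  {ae P, forall t, ln (1 + h t) <= ln (1 + k t) + ln (1 + l t)} ->
  (lnL h <= lnL k + lnL l)%E.
Proof.
move=> mh mk ml h0 k0 l0 hkl.
apply: le_trans (minkowski_EFin _ _ _ p1); try exact: measurable_ln1D.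
apply: (Lnorm_ae_le p1).
- exact: measurable_ln1D.
- by apply: measurable_funD; exact: measurable_ln1D.
- apply: filterS hkl => t hklt /=.
  by rewrite !ger0_norm ?addr_ge0 ?ln1D_ge0.
Qed.

Lemma lnL_bounded h c : measurable_fun setT h -> 0 <= c ->
  (forall t, 0 <= h t <= c) -> (lnL h <= (ln (1 + c))%:E)%E.
Proof.
move=> mh c0 hc; apply: (Lnorm_le_integral p1); first exact: ln1D_ge0.
have P1 : (P : {measure set T -> \bar R}) setT = 1%E by exact: probability_setT.
(* Since [P] has mass one, the constant bound is the integral of a constant function. *)
rewrite -[leRHS]mule1 -P1 -integral_cst//; apply: ge0_le_integral => //.
- by apply: measurable_powR_norm; exact: measurable_ln1D.
- move=> t _; have /andP[h0 hct] := hc t; rewrite lee_fin.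
  rewrite ge0_ler_powR ?nnegrE ?ln1D_ge0 ?(ltW p0)//.
  by rewrite ger0_norm ?ln1D_ge0 ?ler_ln1D.
Qed.

(** Dominated convergence with majorant |g|^p: at each t the truncated function is 0 as soon as n
    exceeds v t. *)
Lemma Lnorm_tail g v : measurable_fun setT g -> measurable_fun setT v ->
  ('N[g] < +oo)%E -> forall e, 0 < e ->
  exists n : nat, ('N[(fun t => if n%:R < v t then g t else 0)%R] < e%:E)%E.
Proof.
move=> mg mv gfin e e0.
pose F (n : nat) t := if n%:R < v t then g t else 0.
have mF n : measurable_fun setT (F n).
  apply: measurable_fun_ifT => //.
  exact: measurable_fun_ltr.
have gint : P.-integrable setT (fun t => (`|g t| `^ p)%:E).
  apply/integrableP; split; first exact: measurable_powR_norm.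
  under eq_integral do rewrite gee0_abs ?lee_fin ?powR_ge0//.
  by rewrite -powR_LnormE// poweR_lty.
have cvgF : {ae P, forall t, setT t ->
    (fun n => (`|F n t| `^ p)%:E) @ \oo --> (0%:E : \bar R)}.
  apply: aeW => t _; apply: cvg_near_cst; near=> n.
  rewrite /F; case: ifPn; last by rewrite normr0 powR0// gt_eqF.
  have : v t < n%:R by near: n; exact: nbhs_infty_gtr.
  by move=> /ltW; rewrite leNgt => /negbTE ->.
have domF : {ae P, forall t n, setT t ->
    (`|(`|F n t| `^ p)%:E| <= (`|g t| `^ p)%:E)%E}.
  apply: aeW => t n _; rewrite gee0_abs ?lee_fin ?powR_ge0//.
  rewrite ge0_ler_powR ?nnegrE ?(ltW p0)// /F.
  by case: ifPn => // _; rewrite normr0.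
have [_ _] := dominated_convergence measurableT
  (fun n => measurable_powR_norm p (mF n)) (measurable_cst _) cvgF gint domF.
rewrite integral0 => /fine_cvgP [].
move=> finI cvgI.
have ep : 0 < e `^ p by rewrite powR_gt0.
have /cvgr0_norm_lt /(_ _ ep) cI := cvgI.
near \oo => n; exists n; apply: (Lnorm_lt_integral p1 e0).
have fI : (\int[P]_t (`|F n t| `^ p)%:E)%E \is a fin_num.
  by near: n.
rewrite -(fineK fI) lte_fin (le_lt_trans (ler_norm _))//.
by near: n.
Unshelve. all: by end_near. Qed.

(** The continuity estimate behind all comparisons of metrics below. By [ler_ln1D_split] and
    Minkowski, the norm for h v is at most n + 1 times the norm for h plus a tail that depends on v
    alone. *)
Lemma lnL_mul_small v : measurable_fun setT v -> (forall t, 0 <= v t) ->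
  (lnL v < +oo)%E -> forall e, 0 < e -> exists2 r, 0 < r &
    forall h, measurable_fun setT h -> (forall t, 0 <= h t) ->
      (lnL h < r%:E)%E -> (lnL (fun t => h t * v t)%R < e%:E)%E.
Proof.
move=> mv v0 vfin e e0.
have e20 : 0 < e / 2 by rewrite divr_gt0.
have [n tail] := Lnorm_tail (measurable_ln1D mv) mv vfin e20.
(* The tail takes one half of e; this r keeps the n + 1 copies of [lnL h] below the other half. *)
exists (e / 2 / n.+1%:R); first by rewrite divr_gt0.
move=> h mh h0 hr.
pose k t := if n%:R < v t then ln (1 + v t) else 0.
have mk : measurable_fun setT k.
  apply: measurable_fun_ifT => //; last exact: measurable_ln1D.
  exact: measurable_fun_ltr.
have mhn : measurable_fun setT (fun t => ln (1 + h t) *+ n.+1).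
  under eq_fun do rewrite -mulr_natr.
  by apply: measurable_funM => //; exact: measurable_ln1D.
apply: (@le_lt_trans _ _ ('N[(fun t => ln (1 + h t) *+ n.+1)%R] + 'N[k])%E).
  apply: le_trans (minkowski_EFin _ mhn mk p1).
  apply: (Lnorm_ae_le p1).
  - by apply: measurable_ln1D; exact: measurable_funM.
  - exact: measurable_funD.
  - apply: aeW => t /=; rewrite ger0_norm ?ln1D_ge0 ?mulr_ge0//.
    by rewrite (le_trans _ (ler_norm _))// ler_ln1D_split.
rewrite [e]splitr EFinD lte_leD//; last exact: ltW.
  by rewrite ge0_fin_numE ?Lnorm_ge0// (lt_trans tail) ?ltry.
rewrite (le_lt_trans (Lnorm_natmul _ p1 _ _))//; first exact: measurable_ln1D.
by rewrite -mule_natr -lte_pdivlMr// -EFinM.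
Qed.

End lnL.

(** * Sequences whose increments have summable logarithms, and Fatou's lemma *)

Section summable_logs.
Context {R : realType}.

(** The right-hand side is the product of the 1 + x_k, whose expansion contains 1 and every x_k. *)
Lemma sum_le_expR (x : nat -> R) n : (forall k, 0 <= x k) ->
  1 + \sum_(0 <= k < n) x k <= expR (\sum_(0 <= k < n) ln (1 + x k)).
Proof.
move=> x0; elim: n => [|n IH]; first by rewrite !big_nil addr0 expR0.
rewrite !big_nat_recr//= expRD lnK ?posrE ?ltr_wpDr//.
apply: (@le_trans _ _ ((1 + \sum_(0 <= k < n) x k) * (1 + x n))).
  rewrite mulrDr mulr1 addrA lerD2l ler_peMl// lerDl.
  exact: sumr_ge0.
by rewrite ler_wpM2r// addr_ge0.
Qed.

(** By [sum_le_expR] the partial sums of x are bounded, so the telescoping series of z converges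
    absolutely. *)
Lemma ln1D_summable_cvg (z x : nat -> R) : (forall k, 0 <= x k) ->
  (forall k, `|z k.+1 - z k| <= x k) ->
  (\sum_(0 <= k <oo) (ln (1 + x k))%:E < +oo)%E -> cvgn z.
Proof.
move=> x0 zx xoo.
have l0 k : (0 <= (ln (1 + x k))%:E)%E by rewrite lee_fin ln1D_ge0.
have Sfin : (\sum_(0 <= k <oo) (ln (1 + x k))%:E)%E \is a fin_num.
  by rewrite ge0_fin_numE//; exact: nneseries_ge0.
have cx : cvgn (series x).
  apply: nondecreasing_is_cvgn.
    by apply: nondecreasing_series => k _ _; exact: x0.
  exists (expR (fine (\sum_(0 <= k <oo) (ln (1 + x k))%:E)%E)) => _ [n _ <-].
  rewrite /series/= (@le_trans _ _ (1 + \sum_(0 <= k < n) x k)) ?lerDr//.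
  rewrite (le_trans (sum_le_expR _ _))// ler_expR -lee_fin fineK// -sumEFin.
  by apply: nneseries_lim_ge => k _ _; exact: l0.
have ct : cvgn (series (telescope z)).
  apply: normed_cvg.
  by apply: (series_le_cvg _ x0 zx cx) => k; exact: normr_ge0.
have -> : z = (fun n => z 0%N + series (telescope z) n).
  by apply/funext => n; rewrite -eq_sum_telescope.
by apply: is_cvgD => //; exact: is_cvg_cst.
Qed.

(** For l > 0 the power function is differentiable at l. At l = 0 it suffices that x_k < e^(1/p)
    eventually. *)
Lemma cvg_powR (x : nat -> R) (l p : R) : 0 < p -> (forall k, 0 <= x k) ->
  x @ \oo --> l -> (fun k => x k `^ p) @ \oo --> l `^ p.
Proof.
move=> p0 x0 xl.
have : 0 <= l by rewrite -(cvg_lim _ xl)//; apply: limr_ge; [exact: cvgP xl|exact: nearW].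
rewrite le_eqVlt => /predU1P[l0|l0].
  rewrite -l0 powR0 ?gt_eqF//; apply/cvgr0Pnorm_lt => e e0.
  have ep : 0 < e `^ p^-1 by rewrite powR_gt0.
  rewrite -l0 in xl; have /cvgr0_norm_lt /(_ _ ep) := xl.
  apply: filterS => k; rewrite ger0_norm// => xk.
  rewrite ger0_norm ?powR_ge0// -[e]powRr1 ?ltW// -(mulVf (lt0r_neq0 p0)).
  by rewrite powRrM gt0_ltr_powR// nnegrE ?powR_ge0.
have dp : derivable (fun y => y `^ p) l 1 :=
  @ex_derive _ _ _ _ _ _ _ (is_derive1_powR p l0).
have cp : {for l, continuous (fun y => y `^ p)}.
  exact/differentiable_continuous/derivable1_diffP.
exact: (continuous_cvg _ cp xl).
Qed.

End summable_logs.

(** Fatou's lemma: g is almost everywhere the lower limit of the F_k, and the lower limit of their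
    integrals is at most c. *)
Lemma ae_cvg_integral_le d (T : measurableType d) (R : realType)
    (mu : {measure set T -> \bar R}) (F : nat -> T -> \bar R) (g : T -> \bar R)
    (c : \bar R) :
  (forall k, measurable_fun setT (F k)) -> (forall k t, 0 <= F k t)%E ->
  measurable_fun setT g -> (forall t, 0 <= g t)%E ->
  {ae mu, forall t, F ^~ t @ \oo --> g t} ->
  (\forall k \near \oo, \int[mu]_t F k t <= c)%E -> (\int[mu]_t g t <= c)%E.
Proof.
move=> mF F0 mg g0 Fg Fc.
apply: (@le_trans _ _ (\int[mu]_t limn_einf (F ^~ t))%E).
  apply: ae_ge0_le_integral => //.
  - move=> t _; rewrite limn_einf_lim; apply: lime_ge; first exact: is_cvg_einfs.
    by apply: nearW => n; apply: le_ereal_inf_tmp => _ [m _ <-]; exact: F0.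
  (* The lower limit is minus the upper limit of the functions - F_k. *)
  - apply: measurableT_comp => //; apply: (@measurable_fun_limn_esup _ _ _ setT
      (fun k t => - F k t)%E) => k.
    exact: measurableT_comp.
  by apply: filterS Fg => t /cvg_limn_einf_sup[-> _].
apply: le_trans (fatou _ _ _ _) _ => //.
rewrite limn_einf_lim; apply: lime_le; first exact: is_cvg_einfs.
near=> k; apply: (@le_trans _ _ (\int[mu]_t F k t)%E); last by near: k.
by apply: ereal_inf_lbound; exists k => /=.
Unshelve. all: by end_near. Qed.

Lemma normc_ge0 (R : realType) (z : R[i]) : 0 <= normc z.
Proof. by case: z => a b; rewrite sqrtr_ge0. Qed.

Lemma measurable_normcB d (T : measurableType d) (R : realType) (f g : T -> R[i]) :
  measurable_fun setT f -> measurable_fun setT g ->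
  measurable_fun setT (fun t => normc (f t - g t)).
Proof.
move=> mf mg; apply: (measurableT_comp (@measurable_normc R)).
have [fr fi] := (measurable_complexP f).1 mf.
have [gr gi] := (measurable_complexP g).1 mg.
apply/measurable_complexP; split.
  rewrite (_ : (fun _ => _) = (fun t => complex.Re (f t) - complex.Re (g t))).
    exact: measurable_funB.
  by apply/funext => t /=; case: (f t); case: (g t).
rewrite (_ : (fun _ => _) = (fun t => complex.Im (f t) - complex.Im (g t))).
  exact: measurable_funB.
by apply/funext => t /=; case: (f t); case: (g t).
Qed.

(** * Completeness of the logarithmic norm for weight 1 *)

Section completeness.
Context d (T : measurableType d) (R : realType) (P : probability T R).
Variables (p : R).
Hypothesis p1 : 1 <= p.

Let p0 : 0 < p. Proof. exact: lt_le_trans p1. Qed.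

(** Hoelder's inequality against the constant 1, whose norm is 1 for a probability. *)
Lemma integral_le_Lnorm (g : T -> R) : measurable_fun setT g ->
  (forall t, 0 <= g t) -> (\int[P]_t (g t)%:E <= 'N[P]_p%:E[EFin \o g])%E.
Proof.
move=> mg g0.
have -> : (\int[P]_t (g t)%:E = 'N[P]_1[EFin \o (g \* cst 1)%R])%E.
  rewrite Lnorm1; apply: eq_integral => t _ /=.
  by rewrite mulr1 ger0_norm.
(* At p = 1 the conjugate exponent is infinite, so this case is treated apart. *)
have [pE1|pN1] := eqVneq p 1.
  by rewrite pE1; under eq_Lnorm do rewrite /= mulr1.
have lt1p : 1 < p by rewrite lt_neqAle eq_sym pN1.
have iq : 0 < 1 - p^-1 by rewrite subr_gt0 invf_lt1.
have := @hoelder _ T R P g (cst 1) p (1 - p^-1)^-1 mg (measurable_cst _) p0.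
rewrite invr_gt0 invrK subrKC => /(_ iq erefl) /le_trans; apply.
have P1 : (P : {measure set T -> \bar R}) setT = 1%E by exact: probability_setT.
by rewrite Lnorm_cst1 P1 invrK -[1%E]/(1%:E) poweR_EFin powR1 mule1.
Qed.

(* Riesz-Fischer: along a subsequence the logarithms [ln (1 + |u_(k+1) - u_k|)]
   are summable almost everywhere, and so are the increments themselves since
   [1 + sum_k x_k <= exp (sum_k ln (1 + x_k))]. *)
Lemma lnL_complete (u : nat -> T -> R[i]) :
  (forall n, measurable_fun setT (u n)) ->
  (forall e, 0 < e -> exists N, forall m n, (N <= m)%N -> (N <= n)%N ->
    (lnL P p (fun t => normc (u m t - u n t)%R) < e%:E)%E) ->
  exists2 f : T -> R[i], measurable_fun setT f &
    forall e, 0 < e -> exists N, forall n, (N <= n)%N ->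
    (lnL P p (fun t => normc (f t - u n t)%R) < e%:E)%E.
Proof.
move=> mu uC.
have e_gt0 k : 0 < 1 / (2 ^ (k + 1))%:R :> R by rewrite divr_gt0// ltr0n expn_gt0.
have /choice [N NP] := fun k => uC _ (e_gt0 k).
(* The sum makes [idx k] exceed every N_j with j <= k; the summand k ensures [idx k >= k], hence
   divergence of the indices. *)
pose idx k := (\sum_(0 <= j < k.+1) N j + k)%N.
have Nidx k j : (j <= k)%N -> (N j <= idx k)%N.
  move=> jk; rewrite /idx (bigD1_seq j) ?iota_uniq ?mem_index_iota//=.
  by rewrite -addnA leq_addr.
pose v k := u (idx k).
pose x k t := normc (v k.+1 t - v k t).
have mv k : measurable_fun setT (v k) by exact: mu.
have mx k : measurable_fun setT (x k) by exact: measurable_normcB.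
have x0 k t : 0 <= x k t by exact: normc_ge0.
have lnx k : (\int[P]_t (ln (1 + x k t))%:E <= (1 / (2 ^ (k + 1))%:R)%:E)%E.
  apply: le_trans (integral_le_Lnorm (measurable_ln1D (mx k)) _) _.
    by move=> t; rewrite ln1D_ge0.
  by apply/ltW/NP; apply: Nidx.
have mlnx k : measurable_fun setT (fun t => (ln (1 + x k t))%:E).
  by apply/measurable_EFinP; exact: measurable_ln1D.
have lnx0 k t : (0 <= (ln (1 + x k t))%:E)%E by rewrite lee_fin ln1D_ge0.
(* The integrals are bounded by 2^-(k+1), so the series of logarithms has integral at most 1 and is
   finite almost everywhere. *)
have sumx : {ae P, forall t, (\sum_(0 <= k <oo) (ln (1 + x k t))%:E < +oo)%E}.
  have iS : P.-integrable setT (fun t => \sum_(0 <= k <oo) (ln (1 + x k t))%:E)%E.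
    apply/integrableP; split.
      by apply: ge0_emeasurable_sum => // k t _ _; exact: lnx0.
    under eq_integral do rewrite gee0_abs ?nneseries_ge0//.
    rewrite integral_nneseries//.
    apply: (@le_lt_trans _ _
        (\sum_(0 <= k <oo) (1 / (2 ^ (k + 1))%:R)%:E)%E).
      by apply: lee_nneseries => k *; [exact: integral_ge0|exact: lnx].
    by rewrite (cvg_lim _ (@cvg_geometric_eseries_half R 1 0))// ltry.
  apply: filterS (integrable_ae measurableT iS) => t /(_ I).
  by rewrite ge0_fin_numE// nneseries_ge0.
have ReB (z w : R[i]) : `|complex.Re z - complex.Re w| <= normc (z - w).
  case: z w => [a b] [c e] /=; rewrite -sqrtr_sqr ler_wsqrtr// lerDl sqr_ge0//.
have ImB (z w : R[i]) : `|complex.Im z - complex.Im w| <= normc (z - w).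
  case: z w => [a b] [c e] /=; rewrite -sqrtr_sqr ler_wsqrtr// lerDr sqr_ge0//.
(* Upper limits are measurable everywhere and agree with the limits where these exist; [fine] sends
   infinite values to 0, which affects only a null set. *)
pose a t := fine (limn_esup (fun k => (complex.Re (v k t))%:E)).
pose b t := fine (limn_esup (fun k => (complex.Im (v k t))%:E)).
pose f t := (a t +i* b t)%C.
have mlimsup (z : nat -> T -> R) : (forall k, measurable_fun setT (z k)) ->
    measurable_fun setT (fun t => fine (limn_esup (fun k => (z k t)%:E))).
  move=> mz; apply: measurableT_comp => //.
  by apply: (@measurable_fun_limn_esup _ _ _ setT (fun k t => (z k t)%:E)) => k;
    exact/measurable_EFinP.
have mf : measurable_fun setT f.
  apply/measurable_complexP; split => /=.
    apply: mlimsup => k.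
    exact: ((measurable_complexP (v k)).1 (mv k)).1.
  apply: mlimsup => k.
  exact: ((measurable_complexP (v k)).1 (mv k)).2.
have fineE (z : nat -> R) : cvgn z ->
    z @ \oo --> fine (limn_esup (fun k => (z k)%:E)).
  move=> cz; have -> : limn_esup (fun k => (z k)%:E) = (limn z)%:E; last exact: cz.
  by apply: (cvg_limn_einf_sup _).2; apply: cvg_EFin cz; exact: nearW.
have vf : {ae P, forall t, (fun k => complex.Re (v k t)) @ \oo --> a t /\
    (fun k => complex.Im (v k t)) @ \oo --> b t}.
  apply: filterS sumx => t St; split; apply: fineE.
    by apply: (ln1D_summable_cvg (fun k => x0 k t) _ St) => k; exact: ReB.
  by apply: (ln1D_summable_cvg (fun k => x0 k t) _ St) => k; exact: ImB.
exists f => // e e0.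
(* Fatou's lemma gives only a weak inequality in the limit, so the Cauchy bound is taken at e /
   2. *)
have e20 : 0 < e / 2 by rewrite divr_gt0.
have [M MP] := uC _ e20; exists M => n Mn.
apply: (@le_lt_trans _ _ (e / 2)%:E); last first.
  by rewrite lte_fin ltr_pdivrMr// ltr_pMr// ltr1n.
apply: (Lnorm_le_integral p1); first exact: ltW.
pose F k t := (`|ln (1 + normc (v k t - u n t))| `^ p)%:E.
have mF k : measurable_fun setT (F k).
  by apply: measurable_powR_norm; apply: measurable_ln1D; exact: measurable_normcB.
apply: (ae_cvg_integral_le mF) => //.
- by move=> k t; rewrite lee_fin powR_ge0.
- by apply: measurable_powR_norm; apply: measurable_ln1D; exact: measurable_normcB.
- apply: filterS vf => t [va vb]; apply: cvg_EFin; first exact: nearW.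
  apply: cvg_powR => //; apply: cvg_norm.
  set z := normc _; have z0 : 0 <= z := normc_ge0 _.
  have cl : {for 1 + z, continuous (@ln R)}.
    by apply: continuous_ln; rewrite ltr_wpDr.
  apply: (continuous_cvg _ cl); apply: cvgD; first exact: cvg_cst.
  rewrite /z; case: (u n t) => c e'; rewrite /f/=.
  have -> : (fun k => normc (v k t - (c +i* e')%C)) = (fun k => Num.sqrt
     ((complex.Re (v k t) - c) ^+ 2 + (complex.Im (v k t) - e') ^+ 2)).
    by apply/funext => k; case: (v k t).
  apply: (continuous_cvg _ (@sqrt_continuous R _)).
  by apply: cvgD; rewrite expr2; apply: cvgM; apply: cvgB => //; exact: cvg_cst.
- exists M => // k /= Mk.
  apply: (integral_Lnorm_lt p1) => //; apply: MP => //.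
  by rewrite (leq_trans Mk)// leq_addl.
Qed.

End completeness.

(** * The topology of a metric in terms of distances *)

Section metrized_theory.
Context {R : realType} {M : choiceType} {dist : M -> M -> R}.
Variable h : is_metric dist.

Lemma metrized_openP (U : set M) :
  open (U : set (metrized h)) <->
  forall x, U x -> exists2 e, 0 < e & forall y, dist x y < e -> U y.
Proof.
rewrite openE; split=> [UU x Ux|UU x Ux].
  have /nbhs_ballP[e e0 eU] := UU x Ux.
  by exists e => // y xy; exact: eU.
have [e e0 eU] := UU x Ux.
by apply/nbhs_ballP; exists e => // y /eU.
Qed.

Lemma metrized_open_ball (x : M) e :
  open ([set y | dist x y < e] : set (metrized h)).
Proof.
apply/metrized_openP => y /= xy; exists (e - dist x y); first by rewrite subr_gt0.
move=> z; rewrite ltrBrDl; apply: le_lt_trans; exact: (dist_triangle h).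
Qed.

Lemma metrized_cvgP (u : nat -> M) (l : M) :
  ((u : nat -> metrized h) @ \oo --> (l : metrized h)) <->
  forall e, 0 < e -> exists N, forall n, (N <= n)%N -> dist l (u n) < e.
Proof.
split=> [/cvg_ballP ul e /ul [N _ NP]|ul].
  by exists N => n /NP.
by apply/cvg_ballP => e /ul [N NP]; exists N => // n /NP.
Qed.

Lemma metrized_cauchyP (u : nat -> M) :
  cauchy ((u : nat -> metrized h) @ \oo) <->
  forall e, 0 < e -> exists N, forall m n, (N <= m)%N -> (N <= n)%N ->
    dist (u m) (u n) < e.
Proof.
split=> [/cauchyP uC e e0|uC].
  have e20 : 0 < e / 2 by rewrite divr_gt0.
  have [x [N _ NP]] := uC _ e20.
  exists N => m n Nm Nn; rewrite [e]splitr.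
  rewrite (le_lt_trans (dist_triangle h x _ _))// ltrD//.
    by rewrite (dist_sym h); exact: NP.
  exact: NP.
apply/cauchyP => e /uC [N NP]; exists (u N); exists N => // n Nn.
exact: NP.
Qed.

Lemma metrized_continuous2 (op : M -> M -> M) :
  (forall x y e, 0 < e -> exists2 r, 0 < r & forall x' y',
    dist x x' < r -> dist y y' < r -> dist (op x y) (op x' y') < e) ->
  continuous ((fun x => op x.1 x.2) : metrized h * metrized h -> metrized h).
Proof.
move=> opc [x y]; apply/cvg_ballP => e /(opc x y) [r r0 rP].
exists (ball (x : metrized h) r, ball (y : metrized h) r) => /=.
  by split; exact: nbhsx_ballx.
by move=> [x' y'] [/= xx' yy']; exact: rP.
Qed.

Lemma metrized_continuous2l (K : numFieldType) (op : K -> M -> M) :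
  (forall x y e, 0 < e -> exists2 r, 0 < r & exists2 s, 0 < s & forall x' y',
    `|x - x'| < s -> dist y y' < r -> dist (op x y) (op x' y') < e) ->
  continuous ((fun x => op x.1 x.2) : K^o * metrized h -> metrized h).
Proof.
move=> opc [x y]; apply/cvg_ballP => e /(opc x y) [r r0 [s s0 rP]].
exists (ball (x : K^o) s, ball (y : metrized h) r) => /=.
  by split; exact: nbhsx_ballx.
by move=> [x' y'] [/= xx' yy']; exact: rP.
Qed.

End metrized_theory.

Lemma same_topologyW (R : realType) (M : choiceType) (dist1 dist2 : M -> M -> R)
  (h1 : is_metric dist1) (h2 : is_metric dist2) :
  (forall x e, 0 < e ->
    exists2 r, 0 < r & forall y, dist2 x y < r -> dist1 x y < e) ->
  (forall U : set M,
    open (U : set (metrized h1)) -> open (U : set (metrized h2))).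
Proof.
move=> d12 U /metrized_openP oU; apply/metrized_openP => x /oU[e e0 eU].
by have [r r0 rP] := d12 x e e0; exists r => // y /rP /eU.
Qed.

(** Converse of [same_topologyW]: the [dist1]-ball around x is open for [dist2], so it contains a
    [dist2]-ball around x. *)
Lemma same_topology_dist (R : realType) (M : choiceType) (dist1 dist2 : M -> M -> R)
  (h1 : is_metric dist1) (h2 : is_metric dist2) :
  (forall U : set M,
    open (U : set (metrized h1)) -> open (U : set (metrized h2))) ->
  forall x e, 0 < e ->
    exists2 r, 0 < r & forall y, dist2 x y < r -> dist1 x y < e.
Proof.
move=> oU x e e0.
have /oU/metrized_openP/(_ x) := @metrized_open_ball _ _ _ h1 x e.
by apply; rewrite /= (dist_xx h1).
Qed.

(** * The norms [lognorm] on classes of measurable functions *)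

Section lognorm_theory.
Context d (T : measurableType d) (R : realType) (P : probability T R).
Variables (p : R).
Hypothesis p1 : 1 <= p.
Implicit Types (f g : L0 P) (v : T -> R).

Let p0 : 0 < p. Proof. exact: lt_le_trans p1. Qed.

Lemma measurable_normcM (f : T -> R[i]) v :
  measurable_fun setT f -> measurable_fun setT v ->
  measurable_fun setT (fun t => normc (f t) * v t).
Proof.
move=> mf mv; apply: measurable_funM => //.
exact: (measurableT_comp (@measurable_normc R)).
Qed.

Lemma measurable_inv_ge0 v : measurable_fun setT v -> (forall t, 0 <= v t) ->
  measurable_fun setT (fun t => (v t)^-1).
Proof.
move=> mv v0; have -> : (fun t => (v t)^-1) = (fun t => v t `^ (-1)).
  by apply/funext => t; rewrite powR_inv1.
exact: (measurableT_comp (@measurable_powR R (-1))).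
Qed.

Lemma lognormE (f : T -> R[i]) v : (forall t, 0 <= v t) ->
  lognorm P p v f = lnL P p (fun t => normc (f t) * v t)%R.
Proof.
move=> v0; rewrite /lognorm /logint /lnL unlock /=.
congr (_ `^ _)%E; apply: eq_integral => t _.
by rewrite ger0_norm// ln1D_ge0// mulr_ge0// normc_ge0.
Qed.

Lemma LwP v f : Lw P p v f <-> (lognorm P p v f < +oo)%E.
Proof.
rewrite /Lw /lognorm/=; split=> [|/lty_poweRy]; first exact: poweR_lty.
by apply; rewrite invr_eq0 gt_eqF.
Qed.

Lemma lognorm_ge0 v (f : T -> R[i]) : (0 <= lognorm P p v f)%E.
Proof. exact: poweR_ge0. Qed.

Section weight.
Variable v : T -> R.
Hypotheses (mv : measurable_fun setT v) (v0 : forall t, 0 <= v t).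

Let mfv f : measurable_fun setT (fun t => normc (f t) * v t).
Proof. by apply: measurable_normcM => //; exact: measurable_L0. Qed.

Let fv0 f t : 0 <= normc (f t) * v t.
Proof. by rewrite mulr_ge0// normc_ge0. Qed.

Lemma lognormD f g :
  (lognorm P p v (f + g : L0 P)%R <= lognorm P p v f + lognorm P p v g)%E.
Proof.
rewrite !lognormE//; apply: lnL_le_add => //.
apply: filterS (L0_addE f g) => t /(_ I) /= ->.
apply: le_trans (ler_ln1D_add (fv0 f t) (fv0 g t)).
rewrite -mulrDl ler_ln1D ?mulr_ge0 ?normc_ge0// ler_wpM2r//.
exact: le_normcD.
Qed.

Lemma lognormN f : lognorm P p v (- f : L0 P)%R = lognorm P p v f.
Proof.
rewrite !lognormE//; apply: lnL_ae_eq => //.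
rewrite -scaleN1r; apply: filterS (L0_scaleE (-1) f) => t /(_ I) /= ->.
by rewrite mulN1r normcN.
Qed.

Lemma lognormBC f g :
  lognorm P p v (f - g : L0 P)%R = lognorm P p v (g - f : L0 P)%R.
Proof. by rewrite -(opprB g f) lognormN. Qed.

Lemma lognormB_le_add f g h : (lognorm P p v (f - h : L0 P)%R <=
  lognorm P p v (f - g : L0 P)%R + lognorm P p v (g - h : L0 P)%R)%E.
Proof. by rewrite -(subrKA g f (- h)); exact: lognormD. Qed.

Lemma lognorm0 : lognorm P p v (0 : L0 P) = 0%E.
Proof.
rewrite lognormE// (@lnL_ae_eq _ _ _ _ _ p1 _ (cst 0))//.
  rewrite /lnL (_ : EFin \o _ = cst 0%E); last first.
    by apply/funext => t /=; rewrite addr0 ln1.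
  by rewrite Lnorm0// eqe gt_eqF.
by apply: filterS (L0_cst0E P) => t /(_ I) ->; rewrite normc0 mul0r.
Qed.

(** A zero norm forces ln (1 + |f| v) = 0 = ln 1 almost everywhere; injectivity of ln gives |f| v =
    0, and v > 0 cancels. *)
Lemma lognorm_eq0 f : {ae P, forall t, 0 < v t} -> lognorm P p v f = 0%E -> f = 0.
Proof.
move=> vpos; rewrite lognormE// => f0; apply: L0_eqP.
have ml : measurable_fun setT (EFin \o (fun t => ln (1 + normc (f t) * v t))).
  by apply/measurable_EFinP; exact: measurable_ln1D.
have p0' : (0 < p%:E)%E by rewrite lte_fin.
have /= lf0 := Lnorm_eq0_eq0 ml p0' f0.
apply: filterS (filterI (filterI lf0 vpos) (L0_cst0E P)) => t [] [] /(_ I) [].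
rewrite -[X in _ = X]ln1 => + vt /(_ I) -> _.
move=> /(@ln_inj R) /=; rewrite !posrE ltr01 ltr_wpDr// => /(_ erefl erefl).
move=> /eqP; rewrite -subr_eq0 addrC addKr mulf_eq0 (gt_eqF vt) orbF => /eqP.
exact: eq0_normc.
Qed.

End weight.

Lemma lognorm1E (f : T -> R[i]) :
  lognorm P p (cst 1%R) f = lnL P p (fun t => normc (f t)).
Proof.
rewrite lognormE//; congr lnL; apply/funext => t; exact: mulr1.
Qed.

Lemma measurable_normc_L0 f : measurable_fun setT (fun t => normc (f t)).
Proof. exact: (measurableT_comp (@measurable_normc R) (measurable_L0 f)). Qed.

Lemma lognorm_mul_small v : measurable_fun setT v -> (forall t, 0 <= v t) ->
  (lnL P p v < +oo)%E -> forall e, 0 < e -> exists2 r, 0 < r &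
    forall f, (lognorm P p (cst 1%R) f < r%:E)%E -> (lognorm P p v f < e%:E)%E.
Proof.
move=> mv v0 vfin e /(lnL_mul_small p1 mv v0 vfin)[r r0 rP].
exists r => // f; rewrite lognorm1E lognormE//; apply: rP.
  exact: measurable_normc_L0.
by move=> t; exact: normc_ge0.
Qed.

(** This is [lnL_mul_small] for the weight 1/v and h = |f| v, as h (1/v) = |f| almost everywhere. *)
Lemma lognorm_div_small v : measurable_fun setT v -> (forall t, 0 <= v t) ->
  {ae P, forall t, 0 < v t} ->
  (lnL P p (fun t => (v t)^-1)%R < +oo)%E -> forall e, 0 < e -> exists2 r, 0 < r &
    forall f, (lognorm P p v f < r%:E)%E -> (lognorm P p (cst 1%R) f < e%:E)%E.
Proof.
move=> mv v0 vpos vfin e.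
have mV : measurable_fun setT (fun t => (v t)^-1) by exact: measurable_inv_ge0.
have V0 t : 0 <= (v t)^-1 by rewrite invr_ge0.
move=> /(lnL_mul_small p1 mV V0 vfin)[r r0 rP].
have mf f := measurable_normc_L0 f.
exists r => // f; rewrite lognorm1E lognormE// => /rP.
rewrite (@lnL_ae_eq _ _ _ _ _ p1 _ (fun t => normc (f t))).
- apply; first exact: measurable_funM.
  by move=> t; rewrite mulr_ge0// normc_ge0.
- by apply: measurable_funM => //; exact: measurable_funM.
- exact: mf.
- by move=> t; rewrite !mulr_ge0// normc_ge0.
- by move=> t; exact: normc_ge0.
- by apply: filterS vpos => t vt; rewrite mulfK// gt_eqF.
Qed.

Lemma lognorm1M f g : (lognorm P p (cst 1%R) (f * g : L0 P)%R <=
  lognorm P p (cst 1%R) f + lognorm P p (cst 1%R) g)%E.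
Proof.
rewrite !lognorm1E; apply: lnL_le_add => //; try exact: measurable_normc_L0;
  try by move=> t; exact: normc_ge0.
apply: filterS (L0_mulE f g) => t /(_ I) /= ->.
by rewrite normcM ler_ln1D_mul ?normc_ge0.
Qed.

(** Here |g| plays the role of the weight in [lnL_mul_small]. *)
Lemma lognorm1M_small g : (lognorm P p (cst 1%R) g < +oo)%E ->
  forall e, 0 < e -> exists2 r, 0 < r & forall f,
    (lognorm P p (cst 1%R) f < r%:E)%E ->
    (lognorm P p (cst 1%R) (f * g : L0 P)%R < e%:E)%E.
Proof.
rewrite lognorm1E => gfin e.
have mg := measurable_normc_L0 g.
have g0 t : 0 <= normc (g t) by exact: normc_ge0.
move=> /(lnL_mul_small p1 mg g0 gfin)[r r0 rP]; exists r => // f.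
have mf := measurable_normc_L0 f.
rewrite !lognorm1E => /rP.
rewrite (@lnL_ae_eq _ _ _ _ _ p1 _ (fun t => normc ((f * g : L0 P) t))).
- apply; first exact: mf.
  by move=> t; exact: normc_ge0.
- exact: measurable_funM.
- exact: measurable_normc_L0.
- by move=> t; rewrite mulr_ge0// normc_ge0.
- by move=> t; exact: normc_ge0.
- by apply: filterS (L0_mulE f g) => t /(_ I) /= ->; rewrite normcM.
Qed.

(** Scaling by c is later treated as multiplication by the constant function c; this bound, from ln
    (1 + |c|) <= |c|, makes that function small with c. *)
Lemma lognorm1_scale1 (c : R[i]) :
  (lognorm P p (cst 1%R) (c *: 1 : L0 P)%R <= (normc c)%:E)%E.
Proof.
rewrite lognorm1E (@lnL_ae_eq _ _ _ _ _ p1 _ (cst (normc c))).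
- apply: (@le_trans _ _ (ln (1 + normc c))%:E).
    by apply: lnL_bounded => //; rewrite ?normc_ge0// => t; rewrite normc_ge0 lexx.
  rewrite lee_fin; apply: le_ln1Dx.
  by rewrite (lt_le_trans _ (normc_ge0 _))// oppr_lt0.
- exact: measurable_normc_L0.
- exact: measurable_cst.
- by move=> t; exact: normc_ge0.
- by move=> t; exact: normc_ge0.
- apply: filterS (filterI (L0_scaleE c (1 : L0 P)) (L0_cst1E P)) => t [] e1 e2.
  by move: e1 e2 => /= /(_ I)-> /(_ I)->; rewrite mulr1.
Qed.

End lognorm_theory.

(** * The translation invariant metrics on L_p *)

Section Lp_metric.
Context d (T : measurableType d) (R : realType) (P : probability T R).
Variables (p : R).
Hypothesis p1 : 1 <= p.

Let p0 : 0 < p := lt_le_trans ltr01 p1.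
Let L := Lp P p0.

Lemma Lp_lognorm1 (f : L) : (lognorm P p (cst 1%R) f < +oo)%E.
Proof. by apply/LwP => //; exact/in_LpP/valP. Qed.

(** Submultiplicativity of 1 + x and Minkowski; this yields the inclusion of L_p in L^v_p when
    [lnL P p v] is finite. *)
Lemma lognorm_le_add (v : T -> R) (f : L0 P) : measurable_fun setT v ->
  (forall t, 0 <= v t) ->
  (lognorm P p v f <= lognorm P p (cst 1%R) f + lnL P p v)%E.
Proof.
move=> mv v0; rewrite lognorm1E lognormE//; apply: lnL_le_add => //.
- by apply: measurable_normcM => //; exact: measurable_L0.
- exact: measurable_normc_L0.
- by move=> t; rewrite mulr_ge0 ?normc_ge0.
- by move=> t; exact: normc_ge0.
- by apply: aeW => t; rewrite ler_ln1D_mul ?normc_ge0.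
Qed.

Section weight.
Variable v : T -> R.
Hypotheses (wv : is_weight P v) (vfin : (lnL P p v < +oo)%E).

Let mv : measurable_fun setT v. Proof. by case: wv. Qed.
Let v0 t : 0 <= v t. Proof. by case: wv. Qed.

Lemma Lp_lognorm (f : L) : (lognorm P p v f < +oo)%E.
Proof.
apply: le_lt_trans (lognorm_le_add _ mv v0) _.
by rewrite lte_add_pinfty// Lp_lognorm1.
Qed.

(** As p >= 1, the exponent [Num.min p 1] is 1, and finiteness on L_p means that [fine] loses
    nothing. Estimates can thus be made on [lognorm]. *)
Lemma EFin_rho_Lp (f g : L) :
  (rho_Lp v f g)%:E = lognorm P p v (Lp_val f - Lp_val g : L0 P)%R.
Proof.
rewrite /rho_Lp /rho_w (min_idPr p1) powRr1 ?fine_ge0 ?lognorm_ge0//.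
rewrite fineK// ge0_fin_numE ?lognorm_ge0//.
exact: (Lp_lognorm (f - g)).
Qed.

Lemma rho_Lp_lt (f g : L) e :
  (rho_Lp v f g < e) = (lognorm P p v (Lp_val f - Lp_val g : L0 P)%R < e%:E)%E.
Proof. by rewrite -lte_fin; congr (_ < _)%E; exact: EFin_rho_Lp. Qed.

Lemma rho_Lp_metric : is_metric (rho_Lp v : L -> L -> R).
Proof.
split.
- by move=> f; apply: EFin_inj; rewrite EFin_rho_Lp subrr lognorm0.
- move=> f g fg; apply/val_inj/eqP; rewrite -subr_eq0; apply/eqP.
  apply: (lognorm_eq0 p1 mv v0); first by case: wv.
  by rewrite -EFin_rho_Lp fg.
- move=> f g; apply: EFin_inj.
  apply: etrans (EFin_rho_Lp f g) _; apply: etrans _ (esym (EFin_rho_Lp g f)).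
  exact: lognormBC.
- move=> g f k; rewrite -lee_fin EFinD.
  have := lognormB_le_add p1 mv v0 (Lp_val f) (Lp_val g) (Lp_val k).
  by move: (EFin_rho_Lp f k) (EFin_rho_Lp f g) (EFin_rho_Lp g k) => <- <- <-.
Qed.

Lemma rho_Lp_translation (f g k : L) : rho_Lp v (f + k) (g + k) = rho_Lp v f g.
Proof.
apply: EFin_inj; apply: etrans (EFin_rho_Lp (f + k) (g + k)) _.
apply: etrans _ (esym (EFin_rho_Lp f g)); congr lognorm; congr L0_fun.
have -> : Lp_val (f + k) = (f : L0 P) + (k : L0 P) by [].
have -> : Lp_val (g + k) = (g : L0 P) + (k : L0 P) by [].
by rewrite opprD addrACA subrr addr0.
Qed.

End weight.

Lemma is_weight1 : is_weight P (fun=> 1 : R).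
Proof. by split => //; apply: aeW. Qed.

Lemma lnL_cst1_lty : (lnL P p (fun=> 1 : R)%R < +oo)%E.
Proof.
apply: (@le_lt_trans _ _ (ln (1 + 1))%:E); last exact: ltry.
by apply: lnL_bounded => // t; rewrite ler01 lexx.
Qed.

Lemma L0_realize (f : T -> R[i]) : measurable_fun setT f ->
  exists F : L0 P, F = f %[ae P].
Proof.
by move=> mf; exists (L0_class P (mfun_Sub (mem_set mf))); exact: L0_classE.
Qed.

Lemma L0_subE (f g : L0 P) : (f - g : L0 P) = (fun t => f t - g t) %[ae P].
Proof.
rewrite -scaleN1r; apply: filterS (filterI (L0_addE f (-1 *: g : L0 P))
  (L0_scaleE (-1) g)) => t [] e1 e2.
by move: e1 e2 => /= /(_ I)-> /= /(_ I)-> _; rewrite mulN1r.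
Qed.

(** Distances between classes may be computed from any chosen pointwise representatives. *)
Lemma lognorm_sub_le (v : T -> R) (f g : L0 P) (h k : T -> R[i]) :
  measurable_fun setT v -> (forall t, 0 <= v t) ->
  measurable_fun setT (fun t => normc (h t - k t)) ->
  f = h %[ae P] -> g = k %[ae P] ->
  lognorm P p v (f - g : L0 P)%R =
    lnL P p (fun t => normc (h t - k t) * v t)%R.
Proof.
move=> mv v0 mhk fh gk; rewrite lognormE//; apply: lnL_ae_eq => //.
- by apply: measurable_normcM => //; exact: measurable_L0.
- exact: measurable_funM.
- by move=> t; rewrite mulr_ge0 ?normc_ge0.
- by move=> t; rewrite mulr_ge0 ?normc_ge0.
apply: filterS (filterI (L0_subE f g) (filterI fh gk)) => t [] e1 [] e2 e3.
by move: e1 e2 e3 => /= /(_ I)-> /(_ I)-> /(_ I)->.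
Qed.

Lemma rho_Lp1_complete : cauchy_complete
  (rho_Lp_metric is_weight1 lnL_cst1_lty).
Proof.
move=> u /metrized_cauchyP uC.
have mu n : measurable_fun setT (Lp_val (u n) : T -> R[i]).
  exact: measurable_L0.
have one0 (t : T) : 0 <= (1 : R) by [].
have sub (f g : L0 P) (h k : T -> R[i]) : measurable_fun setT h ->
    measurable_fun setT k -> f = h %[ae P] -> g = k %[ae P] ->
    lognorm P p (fun=> 1%R) (f - g : L0 P)%R =
    lnL P p (fun t => normc (h t - k t))%R.
  move=> mh mk fh gk; rewrite (lognorm_sub_le _ one0 _ fh gk)//.
    by congr lnL; apply/funext => t; exact: mulr1.
  exact: measurable_normcB.
have rfl (f : L0 P) : (f : T -> R[i]) = f %[ae P] by apply: aeW.
have uC' e : 0 < e -> exists N, forall m n, (N <= m)%N -> (N <= n)%N ->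
    (lnL P p (fun t => normc (Lp_val (u m) t - Lp_val (u n) t))%R < e%:E)%E.
  move=> e0; have [N NP] := uC e e0; exists N => m n Nm Nn.
  rewrite -(sub _ _ _ _ (mu m) (mu n) (rfl _) (rfl _)).
  by have := NP m n Nm Nn; rewrite (rho_Lp_lt is_weight1 lnL_cst1_lty).
have [f mf fP] := lnL_complete p1 mu uC'.
have [F Ff] := L0_realize mf.
have Fu n : lognorm P p (fun=> 1%R) (F - Lp_val (u n) : L0 P)%R =
    lnL P p (fun t => normc (f t - Lp_val (u n) t))%R.
  exact: (sub _ _ _ _ mf (mu n) Ff (rfl _)).
(* A single term at finite distance from the limit puts the limit in L_p: F = (F - u_N) + u_N. *)
have [N NP] := fP 1 ltr01.
have LF : F \in in_Lp p0.
  rewrite -(subrK (Lp_val (u N)) F); apply: rpredD; last exact: valP.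
  by apply/in_LpP/LwP => //; rewrite Fu (lt_trans (NP N (leqnn N))) ?ltry.
exists (MkLp LF : metrized _); apply/metrized_cvgP => e /fP[{NP}M MP].
exists M => n /MP; rewrite (rho_Lp_lt is_weight1 lnL_cst1_lty)/= Fu//.
Qed.

End Lp_metric.

(** * The implications between the statements, through ln (1 + 1/w) *)

Section implications.
Context d (T : measurableType d) (R : realType) (P : probability T R).
Variables (p : R).
Hypothesis p1 : 1 <= p.

Let p0 : 0 < p := lt_le_trans ltr01 p1.
Let L := Lp P p0.
Let rho (v : T -> R) : L -> L -> R := rho_Lp v.
Local Notation N1 f := (lognorm P p (cst 1%R) (L0_fun f)).

(** With a = x - x' and b = y - y', the difference is a y + (b x - a b). The first two products are
    small by [lognorm1M_small], and a b costs at most the sum of the norms of a and b, hence e/3/2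
    for each. *)
Lemma lognorm1_mul_continuous (x y : L0 P) : (N1 x < +oo)%E -> (N1 y < +oo)%E ->
  forall e, 0 < e -> exists2 r, 0 < r & forall x' y',
    (N1 (x - x' : L0 P)%R < r%:E -> N1 (y - y' : L0 P)%R < r%:E ->
      N1 (x * y - x' * y' : L0 P)%R < e%:E)%E.
Proof.
move=> xfin yfin e e0.
have e3 : 0 < e / 3 by rewrite divr_gt0.
have [r1 r1_gt0 r1P] := lognorm1M_small p1 yfin e3.
have [r2 r2_gt0 r2P] := lognorm1M_small p1 xfin e3.
pose r3 := e / 3 / 2; have r3_gt0 : 0 < r3 by rewrite divr_gt0.
exists (Num.min r1 (Num.min r2 r3)); first by rewrite !lt_min r1_gt0 r2_gt0.
have minP z : (z < (Num.min r1 (Num.min r2 r3))%:E ->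
    [/\ z < r1%:E, z < r2%:E & z < r3%:E])%E.
  by move=> zr; split; apply: lt_le_trans zr _;
    rewrite lee_fin !ge_min lexx ?orbT.
move=> x' y' /minP[ar1 _ ar3] /minP[_ br2 br3].
set a := x - x' in ar1 ar3 *; set b := y - y' in br2 br3 *.
have -> : x * y - x' * y' = a * y + (b * x - a * b).
  by rewrite /a /b; ring.
have mc : measurable_fun setT (cst 1 : T -> R) by [].
have c0 (t : T) : 0 <= cst 1 t :> R by [].
rewrite (_ : e = e / 3 + (e / 3 + (r3 + r3))); last by rewrite /r3; field.
apply: le_lt_trans (lognormD p1 mc c0 _ _) _.
rewrite EFinD; apply: lteD; first exact: r1P.
apply: le_lt_trans (lognormD p1 mc c0 _ _) _.
rewrite EFinD; apply: lteD; first exact: r2P.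
rewrite lognormN//; apply: le_lt_trans (lognorm1M p1 _ _) _.
rewrite EFinD; exact: (lteD ar3 br3).
Qed.

Section weight.
Variable w : T -> R.
Hypotheses (ww : is_weight P w) (wfin : (lnL P p w < +oo)%E).

Let mw : measurable_fun setT w. Proof. by case: ww. Qed.
Let w0 t : 0 <= w t. Proof. by case: ww. Qed.
Let wpos : {ae P, forall t, 0 < w t}. Proof. by case: ww. Qed.
Let mV : measurable_fun setT (fun t => (w t)^-1).
Proof. exact: measurable_inv_ge0. Qed.
Let V0 t : 0 <= (w t)^-1. Proof. by rewrite invr_ge0. Qed.
Let one1 := is_weight1 P.
Let one1fin := lnL_cst1_lty P p1.

Lemma rho_Lp1_small e : 0 < e -> exists2 r, 0 < r &
  forall f g : L, rho (fun=> 1) f g < r -> rho w f g < e.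
Proof.
move=> /(lognorm_mul_small p1 mw w0 wfin)[r r0 rP]; exists r => // f g.
move=> fg; apply: etrans (rho_Lp_lt ww wfin f g e) _; apply: rP.
exact: etrans (esym (rho_Lp_lt one1 one1fin f g r)) fg.
Qed.

Lemma rho_Lp_small : (lnL P p (fun t => (w t)^-1)%R < +oo)%E ->
  forall e, 0 < e -> exists2 r, 0 < r &
  forall f g : L, rho w f g < r -> rho (fun=> 1) f g < e.
Proof.
move=> Vfin e /(lognorm_div_small p1 mw w0 wpos Vfin)[r r0 rP]; exists r => // f g.
move=> fg; apply: etrans (rho_Lp_lt one1 one1fin f g e) _; apply: rP.
exact: etrans (esym (rho_Lp_lt ww wfin f g r)) fg.
Qed.

Lemma lnLV_same_topology : (lnL P p (fun t => (w t)^-1)%R < +oo)%E ->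
  same_topology (rho w) (rho (fun=> 1)).
Proof.
move=> Vfin; exists (rho_Lp_metric p1 ww wfin), (rho_Lp_metric p1 one1 one1fin) => U.
split; apply: same_topologyW => x e e0.
  by have [r r0 rP] := rho_Lp1_small e0; exists r => // y; exact: rP.
by have [r r0 rP] := rho_Lp_small Vfin e0; exists r => // y; exact: rP.
Qed.

(** Neighbourhoods of 0 are comparable, and translation invariance makes the comparison uniform: a
    Cauchy sequence for [rho w] is Cauchy for the weight 1, and its limit there is a limit for
    [rho w]. *)
Lemma same_topology_complete :
  same_topology (rho w) (rho (fun=> 1)) -> complete_metric_space (rho w).
Proof.
move=> [h1 [h2 oU]]; exists h1 => u /metrized_cauchyP uC.
have trans v (wv : is_weight P v) (vfin : (lnL P p v < +oo)%E) (f g : L) :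
    rho v f g = rho v 0 (g - f).
  have := rho_Lp_translation wv vfin 0 (g - f) f.
  by rewrite add0r subrK.
have d21 := same_topology_dist (fun U => (oU U).2).
have d12 := same_topology_dist (fun U => (oU U).1).
have /metrized_cauchyP uC1 : forall e, 0 < e -> exists N, forall m n,
    (N <= m)%N -> (N <= n)%N -> rho (fun=> 1) (u m) (u n) < e.
  move=> e /(d21 0)[r /uC[N NP] rP]; exists N => m n Nm Nn.
  have := NP m n Nm Nn.
  move: (trans _ one1 one1fin (u m) (u n)) (trans _ ww wfin (u m) (u n)).
  by move=> -> -> /rP.
have [l /metrized_cvgP ul] := rho_Lp1_complete (uC1 (rho_Lp_metric p1 one1 one1fin)).
exists l; apply/metrized_cvgP => e /(d12 0)[r /ul[N NP] rP].
exists N => n Nn; have := NP n Nn.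
move/(etrans (esym (congr1 (< r) (trans _ one1 one1fin l (u n))))) => /rP.
exact: etrans (congr1 (< e) (trans _ ww wfin l (u n))).
Qed.

(** One inclusion writes |f| = (|f| w)(1/w) almost everywhere; the other is [lognorm_le_add]. *)
Lemma lnLV_LwE : (lnL P p (fun t => (w t)^-1)%R < +oo)%E ->
  Lw P p w = Lw P p (fun=> 1).
Proof.
move=> Vfin; apply/seteqP; split => f /(LwP p1) ffin; apply/(LwP p1).
  have mf : measurable_fun setT (fun t => normc (f t) * w t).
    by apply: measurable_normcM => //; exact: measurable_L0.
  have f0 t : 0 <= normc (f t) * w t by rewrite mulr_ge0 ?normc_ge0.
  rewrite lognorm1E; apply: (@le_lt_trans _ _
      (lognorm P p w f + lnL P p (fun t => (w t)^-1)%R)%E); last first.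
    exact: lte_add_pinfty.
  rewrite lognormE//; apply: lnL_le_add => //.
  - exact: measurable_normc_L0.
  - by move=> t; exact: normc_ge0.
  apply: filterS wpos => t wt; apply: le_trans (ler_ln1D_mul (f0 t) (V0 t)).
  by rewrite mulfK// gt_eqF.
apply: le_lt_trans (lognorm_le_add p1 f mw w0) _.
exact: lte_add_pinfty.
Qed.

Let mVC (c : R) : measurable_fun setT (fun t => (Num.min (w t)^-1 c)%:C%C).
Proof.
apply/measurable_complexP; split => /=; last exact: measurable_cst.
exact: measurable_minr.
Qed.

Let mVCy : measurable_fun setT (fun t => ((w t)^-1)%:C%C).
Proof. by apply/measurable_complexP; split => //=; exact: measurable_cst. Qed.

Let normc_real (x : R) : 0 <= x -> normc (x%:C)%C = x.
Proof. by move=> x0; rewrite /= expr0n addr0 sqrtr_sqr ger0_norm. Qed.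

Let lnLVE (F : L0 P) : F = (fun t => ((w t)^-1)%:C%C) %[ae P] ->
  lognorm P p (cst 1%R) F = lnL P p (fun t => (w t)^-1)%R.
Proof.
move=> FV; rewrite lognorm1E; apply: lnL_ae_eq => //.
- exact: measurable_normc_L0.
- by move=> t; exact: normc_ge0.
- by apply: filterS FV => t /(_ I) ->; rewrite normc_real.
Qed.

(** The function 1/w lies in L^w_p because (1/w) w = 1 almost everywhere, so the equality puts it in
    L_p. *)
Lemma LwE_lnLV : Lw P p w = Lw P p (fun=> 1) ->
  (lnL P p (fun t => (w t)^-1)%R < +oo)%E.
Proof.
have [F FV] := L0_realize P mVCy; move=> /seteqP[ww1 _].
rewrite -(lnLVE FV); apply/(LwP p1)/ww1.
apply/(LwP p1); apply: (@le_lt_trans _ _ (lnL P p (fun=> 1%R))) => //.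
rewrite lognormE//; apply: (lnL_ae_le p1) => //.
- by apply: measurable_normcM => //; exact: measurable_L0.
- by move=> t; rewrite mulr_ge0 ?normc_ge0.
apply: filterS (filterI FV wpos) => t [] /(_ I) -> wt.
by rewrite normc_real// mulVf// gt_eqF.
Qed.

Lemma complete_lnLV : complete_metric_space (rho w) ->
  (lnL P p (fun t => (w t)^-1)%R < +oo)%E.
Proof.
move=> [h hC].
have [F FV] := L0_realize P mVCy.
have /choice[f fV] := fun n : nat => L0_realize P (mVC n%:R).
have Lf n : f n \in in_Lp p0.
  apply/in_LpP/(LwP p1); rewrite lognorm1E.
  apply: (@le_lt_trans _ _ (ln (1 + n%:R))%:E); last exact: ltry.
  rewrite (@lnL_ae_eq _ _ _ _ _ p1 _ (fun t => Num.min (w t)^-1 n%:R)).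
  - apply: lnL_bounded => //; first exact: measurable_minr.
    by move=> t; rewrite le_min V0 ler0n ge_min lexx orbT.
  - exact: measurable_normc_L0.
  - exact: measurable_minr.
  - by move=> t; exact: normc_ge0.
  - by move=> t; rewrite le_min V0 ler0n.
  - apply: filterS (fV n) => t /(_ I) ->; rewrite normc_real//.
    by rewrite le_min V0 ler0n.
pose u n : L := MkLp (Lf n).
have ln2fin : ('N[P]_p%:E[EFin \o cst (ln 2%R)] < +oo)%E.
  by rewrite -(@Lfun_lty _ _ _ _ _ (cst (ln 2))) ?Lfun_cst.
have tail := Lnorm_tail p1 (@measurable_cst _ _ T R setT (ln 2)) mV ln2fin.
(* Both a and b lie between 0 and 1/w, so |a - b| w <= 1 and the logarithm is at most ln 2 where 1/w
   > N; it vanishes elsewhere. The bound is the tail of the constant ln 2, which serves both for the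
   Cauchy property and for the limit. *)
have small (N : nat) (A B : L0 P) (a b : T -> R) :
    measurable_fun setT (fun t => (a t)%:C%C) ->
    measurable_fun setT (fun t => (b t)%:C%C) ->
    A = (fun t => (a t)%:C%C) %[ae P] -> B = (fun t => (b t)%:C%C) %[ae P] ->
    (forall t, 0 <= a t <= (w t)^-1) -> (forall t, 0 <= b t <= (w t)^-1) ->
    (forall t, (w t)^-1 <= N%:R -> a t = b t) ->
    (lognorm P p w (A - B : L0 P)%R <= 'N[P]_p%:E[EFin \o
      (fun t => if (N%:R < (w t)^-1)%R then ln 2 else 0%R)])%E.
  move=> ma mb Aa Bb aV bV ab.
  have mab := measurable_normcB ma mb.
  rewrite (lognorm_sub_le p1 mw w0 mab Aa Bb); apply: (Lnorm_ae_le p1).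
  - by apply: measurable_ln1D; exact: measurable_funM.
  - by apply: measurable_fun_ifT => //; exact: measurable_fun_ltr.
  apply: filterS wpos => t wt; rewrite ger0_norm; last first.
    by rewrite ln1D_ge0// mulr_ge0 ?normc_ge0.
  case: ltP => [_|/ab ->]; last by rewrite subrr normc0 mul0r addr0 ln1 normr0.
  rewrite (le_trans _ (ler_norm _))// (_ : 2 = 1 + 1 :> R)//.
  apply: ler_ln1D; first by rewrite mulr_ge0 ?normc_ge0.
  rewrite -ler_pdivlMr// mul1r -rmorphB /= expr0n addr0 sqrtr_sqr.
  have /andP[a0 aVt] := aV t; have /andP[b0 bVt] := bV t.
  by rewrite ler_norml; apply/andP; split; lra.
have minV n t : 0 <= Num.min (w t)^-1 n%:R <= (w t)^-1.
  by rewrite le_min V0 ler0n ge_min lexx.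
have minE N n t : (N <= n)%N -> (w t)^-1 <= N%:R -> Num.min (w t)^-1 n%:R = (w t)^-1.
  by move=> Nn wN; apply/min_idPl/(le_trans wN); rewrite ler_nat.
have uC e : 0 < e -> exists N, forall m n, (N <= m)%N -> (N <= n)%N ->
    rho w (u m) (u n) < e.
  move=> /tail[N NP]; exists N => m n Nm Nn.
  apply: etrans (rho_Lp_lt ww wfin (u m) (u n) _) _.
  apply: le_lt_trans NP; apply: (small _ _ _ _ _ (mVC _) (mVC _) (fV m) (fV n)) => //.
  by move=> t tN; rewrite !(minE N).
have [l /metrized_cvgP ul] := hC u ((metrized_cauchyP h u).2 uC).
(* The limit l belongs to L_p by its type, so identifying it with 1/w finishes the proof. *)
suff lF : Lp_val l = F by rewrite -(lnLVE FV) -lF; exact: Lp_lognorm1.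
apply/eqP; rewrite -subr_eq0; apply/eqP/(lognorm_eq0 p1 mw w0 wpos).
apply/eqP; rewrite eq_le lognorm_ge0 andbT; apply/lee_addgt0Pr => e e0.
rewrite add0e; have e20 : 0 < e / 2 by rewrite divr_gt0.
have [N NP] := tail _ e20; have [M MP] := ul _ e20.
pose n := maxn N M.
apply: le_trans (lognormB_le_add p1 mw w0 _ (f n) _) _.
rewrite [e]splitr EFinD; apply: leeD; apply: ltW.
  apply: etrans (esym (rho_Lp_lt ww wfin l (u n) _)) _.
  by apply: MP; rewrite leq_maxr.
apply: le_lt_trans NP.
apply: (small _ _ _ _ _ (mVC _) mVCy (fV n) FV) => [t|t|t].
- exact: minV.
- by rewrite V0 lexx.
- by apply: minE; rewrite leq_maxl.
Qed.

(** Addition is continuous by the triangle inequality. For both multiplications, [rho_Lp_small]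
    passes to the weight 1, where [lognorm1_mul_continuous] applies, and [lognorm_mul_small] returns
    to w. *)
Lemma lnLV_F_algebra : (lnL P p (fun t => (w t)^-1)%R < +oo)%E ->
  F_algebra (K := R[i]) (rho w).
Proof.
move=> Vfin; have [h hC] := same_topology_complete (lnLV_same_topology Vfin).
exists h; split; first exact: hC.
- exact: rho_Lp_translation.
- apply: (metrized_continuous2 (op := fun x y : L => x + y)) => x y e e0.
  exists (e / 2); first by rewrite divr_gt0.
  move=> x' y' xx' yy'.
  apply: etrans (rho_Lp_lt ww wfin (x + y) (x' + y') e) _.
  have -> : Lp_val (x + y) - Lp_val (x' + y') =
      (Lp_val x - Lp_val x' : L0 P) + (Lp_val y - Lp_val y' : L0 P).
    by rewrite addrACA -opprD.
  apply: le_lt_trans (lognormD p1 mw w0 _ _) _.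
  rewrite [e]splitr EFinD; apply: lteD.
    exact: etrans (esym (rho_Lp_lt ww wfin x x' _)) xx'.
  exact: etrans (esym (rho_Lp_lt ww wfin y y' _)) yy'.
- apply: (metrized_continuous2l (op := fun (c : R[i]) (y : L) => c *: y)) => c y e e0.
  have [r r0 rP] := lognorm_mul_small p1 mw w0 wfin e0.
  have cfin : (lognorm P p (cst 1%R) (c *: 1 : L0 P)%R < +oo)%E.
    by apply: le_lt_trans (lognorm1_scale1 P p1 c) _; exact: ltry.
  have [s s0 sP] := lognorm1_mul_continuous cfin (Lp_lognorm1 y) r0.
  have [q q0 qP] := rho_Lp_small Vfin s0.
  (* Balls of the scalar field have radii in [R[i]], hence the real radius s is embedded there. *)
  exists q => //; exists (s%:C)%C; first by rewrite ltcR.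
  move=> c' y' cc' yy'.
  apply: etrans (rho_Lp_lt ww wfin (c *: y) (c' *: y') e) _.
  have -> : Lp_val (c *: y) - Lp_val (c' *: y') =
      (c *: 1 : L0 P) * Lp_val y - (c' *: 1 : L0 P) * Lp_val y'.
    by rewrite -!scalerAl !mul1r.
  apply/rP/sP.
    rewrite -scalerBl; apply: le_lt_trans (lognorm1_scale1 P p1 _) _.
    by rewrite lte_fin -ltcR.
  apply: etrans (esym (rho_Lp_lt one1 one1fin y y' _)) _.
  exact: qP.
- apply: (metrized_continuous2 (op := fun x y : L => x * y)) => x y e e0.
  have [r r0 rP] := lognorm_mul_small p1 mw w0 wfin e0.
  have [s s0 sP] := lognorm1_mul_continuous (Lp_lognorm1 x) (Lp_lognorm1 y) r0.
  have [q q0 qP] := rho_Lp_small Vfin s0.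
  exists q; first exact: q0.
  move=> x' y' xx' yy'.
  apply: etrans (rho_Lp_lt ww wfin (x * y) (x' * y') e) _.
  apply: rP; apply: (sP (Lp_val x') (Lp_val y')).
    by apply: etrans (esym (rho_Lp_lt one1 one1fin x x' _)) _; exact: qP.
  by apply: etrans (esym (rho_Lp_lt one1 one1fin y y' _)) _; exact: qP.
Qed.

End weight.
End implications.

(** * Integrability of ln w against that of ln (1 + w) and ln (1 + 1/w) *)

Lemma Lfun_ln_lnLV d (T : measurableType d) (R : realType) (P : probability T R)
    (p : R) (w : T -> R) : 1 <= p -> is_weight P w ->
  (fun t => ln (w t)) \in Lfun P p%:E ->
  (lnL P p (fun t => (w t)^-1)%R < +oo)%E.
Proof.
move=> p1 [mw w0 _] lw.
have mlw : measurable_fun setT (fun t => ln (w t)) by exact: measurableT_comp.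
have mlV := measurable_ln1D (measurable_inv_ge0 mw w0).
have := lw; rewrite Lfun_lty// => Nlw.
apply: (@le_lt_trans _ _ ('N[P]_p%:E[EFin \o (cst (ln 2%R))] +
    'N[P]_p%:E[EFin \o (fun t => `|ln (w t)|)%R])%E).
  apply: le_trans (minkowski_EFin _ _ _ p1) => //; last exact: measurableT_comp.
  apply: (Lnorm_ae_le p1) => //.
    by apply: measurable_funD => //; exact: measurableT_comp.
  apply: aeW => t; rewrite ger0_norm ?ln1D_ge0 ?invr_ge0//.
  by apply: le_trans (ler_norm _); exact: ler_ln1DV.
apply: lte_add_pinfty.
  by rewrite -(@Lfun_lty _ _ _ _ _ (cst (ln 2))) ?Lfun_cst.
rewrite (le_lt_trans _ Nlw)//; apply: (Lnorm_ae_le p1) => //.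
  exact: measurableT_comp.
by apply: aeW => t; rewrite normr_id.
Qed.

Lemma lnLV_Lfun_ln d (T : measurableType d) (R : realType) (P : probability T R)
    (p : R) (w : T -> R) : 1 <= p -> is_weight P w ->
  (fun t => Num.max (ln (w t)) 0) \in Lfun P p%:E ->
  (lnL P p (fun t => (w t)^-1)%R < +oo)%E ->
  (fun t => ln (w t)) \in Lfun P p%:E.
Proof.
move=> p1 [mw w0 _] lw Vfin.
have mlw : measurable_fun setT (fun t => ln (w t)) by exact: measurableT_comp.
have mmax : measurable_fun setT (fun t => Num.max (ln (w t)) 0).
  exact: measurable_maxr.
have mlV := measurable_ln1D (measurable_inv_ge0 mw w0).
have := lw; rewrite !Lfun_lty// => Nlw.
apply: le_lt_trans (lte_add_pinfty Nlw Vfin).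
apply: le_trans (minkowski_EFin _ mmax mlV p1).
apply: (Lnorm_ae_le p1) => //; first exact: measurable_funD.
by apply: aeW => t; apply: le_trans (ler_norm _); exact: norm_ln_le.
Qed.

(** Converts the standing hypothesis on the positive part of ln w into the finiteness used by the
    implications, through [ler_ln1D_max] and Minkowski. *)
Lemma Lfun_ln_max_lnL d (T : measurableType d) (R : realType) (P : probability T R)
    (p : R) (w : T -> R) : 1 <= p -> is_weight P w ->
  (fun t => Num.max (ln (w t)) 0) \in Lfun P p%:E -> (lnL P p w < +oo)%E.
Proof.
move=> p1 [mw w0 _] lw.
have mmax : measurable_fun setT (fun t => Num.max (ln (w t)) 0).
  by apply: measurable_maxr => //; exact: measurableT_comp.
have := lw; rewrite Lfun_lty// => Nlw.
have N2 : ('N[P]_p%:E[EFin \o (cst (ln 2%R))] < +oo)%E.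
  by rewrite -(@Lfun_lty _ _ _ _ _ (cst (ln 2))) ?Lfun_cst.
apply: le_lt_trans (lte_add_pinfty N2 Nlw).
apply: le_trans (minkowski_EFin _ _ mmax p1) => //.
apply: (Lnorm_ae_le p1); [exact: measurable_ln1D|exact: measurable_funD|].
apply: aeW => t; rewrite ger0_norm ?ln1D_ge0//.
by apply: le_trans (ler_norm _); exact: ler_ln1D_max.
Qed.

Theorem theorem6p7 (R : realType) (p : R) (p1 : 1 <= p)
  (w : circle R -> R) (hw : is_weight circle_measure w)
  (hlog : (fun t => Num.max (ln (w t)) 0) \in Lfun circle_measure p%:E) :
  let L_p := Lp circle_measure (lt_le_trans ltr01 p1) in
  let rho (v : circle R -> R) : L_p -> L_p -> R := rho_Lp v in
  [<-> (fun t => ln (w t)) \in Lfun circle_measure p%:E;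
       Lw circle_measure p w = Lw circle_measure p (fun=> 1);
       same_topology (rho w) (rho (fun=> 1));
       complete_metric_space (rho w);
       F_algebra (K := R[i]) (rho w)].
Proof.
move=> L_p rho; have wfin := Lfun_ln_max_lnL p1 hw hlog.
(* The implications form a cycle; all but the third pass through the finiteness of [lnL] at 1/w. *)
tfae.
- by move=> /(Lfun_ln_lnLV p1 hw) /(lnLV_LwE p1 hw wfin).
- by move=> /(LwE_lnLV p1 hw) /(lnLV_same_topology p1 hw wfin).
- exact: same_topology_complete hw wfin.
- by move=> /(complete_lnLV hw wfin) /(lnLV_F_algebra p1 hw wfin).
- move=> [h [hC _ _ _ _]].
  have Vfin := complete_lnLV hw wfin (ex_intro _ h hC).
  exact: lnLV_Lfun_ln p1 hw hlog Vfin.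
Qed.
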